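(* Let $\mathcal{A}=\mathcal{A}_n^{\bar q,\Lambda}(\mathbb{K})$ with no $q_k$ a root of unity, let $\mathcal{A}[t]=\mathcal{A}\otimes_{\mathbb{K}}\mathbb{K}[t]$, and let $\varphi$ be a $\mathbb{K}$-algebra automorphism of $\mathcal{A}[t]$. Then there exist a partition $\{1,\dots,n\}=P_1\cup P_2$, a permutation $\sigma$ of $\{1,\dots,n\}$ satisfying: $q_{\sigma(i)}=q_i$ for $i\in P_1$, $q_{\sigma(i)}=q_i^{-1}$ for $i\in P_2$, $\lambda_{\sigma(i)\sigma(j)}=\lambda_{ij}$ for $i,j$ in the same part, $\lambda_{\sigma(i)\sigma(j)}=\lambda_{ij}^{-1}$ for $i\in P_1,j\in P_2$; and scalars $\alpha_1,\dots,\alpha_n,a\in\mathbb{K}^*$, $b\in\mathbb{K}$, such that $\varphi(x_i)=\alpha_ix_{\sigma(i)},\ \varphi(y_i)=\alpha_i^{-1}y_{\sigma(i)}$ for $i\in P_1$, $\varphi(x_i)=\alpha_iy_{\sigma(i)},\ \varphi(y_i)=-q_i^{-1}\alpha_i^{-1}x_{\sigma(i)}$ for $i\in P_2$, and $\varphi(t)=at+b$.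
   Context: Let $\mathbb{K}$ be a field, $n\ge 1$, $\bar q=(q_1,\dots,q_n)\in(\mathbb{K}^* )^n$, and $\Lambda=(\lambda_{ij})$ an $n\times n$ matrix over $\mathbb{K}^*$ with $\lambda_{ij}=\lambda_{ji}^{-1}$, $\lambda_{ii}=1$. $\mathcal{A}_n^{\bar q,\Lambda}(\mathbb{K})$ is the $\mathbb{K}$-algebra generated by $x_1,y_1,\dots,x_n,y_n$ with relations: for $1\le i<j\le n$, $x_ix_j=\lambda_{ij}x_jx_i$, $y_jy_i=\lambda_{ji}y_iy_j$, $x_iy_j=\lambda_{ji}y_jx_i$, $x_jy_i=\lambda_{ij}y_ix_j$; and $x_iy_i-q_iy_ix_i=1$ for all $i$. $t$ is a central polynomial variable. *)

(* Defs.v *)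
From HB Require Import structures.
From mathcomp Require Import all_boot all_order all_algebra all_fingroup.
Set Implicit Arguments. Unset Strict Implicit. Unset Printing Implicit Defensive.
Import Order.TTheory GRing.Theory Num.Theory.
Local Open Scope ring_scope.

Definition good_params (K : fieldType) (n : nat) (q : 'I_n -> K) (lam : 'M[K]_n) :=
  (forall i, q i != 0) /\
  (forall i j, lam i j != 0) /\
  (forall i j, lam i j = (lam j i)^-1) /\
  (forall i, lam i i = 1).

Definition no_root_of_unity (K : fieldType) (n : nat) (q : 'I_n -> K) :=
  forall k (m : nat), (0 < m)%N -> q k ^+ m != 1.

Definition Aqt_relations (K : fieldType) (n : nat) (q : 'I_n -> K) (lam : 'M[K]_n)
    (S : algType K) (x y : 'I_n -> S) (t : S) : Prop :=
  (forall i j : 'I_n, (i < j)%N ->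
     [/\ x i * x j = lam i j *: (x j * x i),
         y j * y i = lam j i *: (y i * y j),
         x i * y j = lam j i *: (y j * x i)
       & x j * y i = lam i j *: (y i * x j)]) /\
  (forall i, x i * y i - q i *: (y i * x i) = 1) /\
  (forall i, t * x i = x i * t /\ t * y i = y i * t).

(* (R, x, y, t) is a presentation of A[t] = A_n^{q,Lambda}(K) (x)_K K[t]:
   the generators satisfy the relations, and (R,x,y,t) is universal among
   K-algebras with such elements. *)
Definition is_Aqt (K : fieldType) (n : nat) (q : 'I_n -> K) (lam : 'M[K]_n)
    (R : algType K) (x y : 'I_n -> R) (t : R) : Prop :=
  Aqt_relations q lam x y t /\
  forall (S : algType K) (X Y : 'I_n -> S) (T : S),
    Aqt_relations q lam X Y T ->
    (exists f : {lrmorphism R -> S},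
        (forall i, f (x i) = X i /\ f (y i) = Y i) /\ f t = T) /\
    (forall f g : {lrmorphism R -> S},
        (forall i, f (x i) = X i /\ f (y i) = Y i) -> f t = T ->
        (forall i, g (x i) = X i /\ g (y i) = Y i) -> g t = T ->
        forall r, f r = g r).

(* Main.v *)
(* Let z_i = 1 + (q_i - 1) y_i x_i.  Sending x_i to itself and y_i to
   (q_i - 1)^-1 (z_i - 1) x_i^-1 embeds A[t] into the quantum torus in the
   variables x_i, z_i, t: the leading exponents of the spanning monomials
   y^a x^b t^k are pairwise distinct.  In the torus the leading and the lowest
   exponents of a product are the sums of those of its factors.  Hence, if u is a
   normal element and u x_i = r u, then r is a multiple of the monomial x_i, and
   likewise for z_i; since (y_i, - q_i x_i) satisfy the relations for q_i^-1, the
   same holds for y_i.  So u commutes with all z_i and u = z^m p(t).  An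
   automorphism phi permutes the normal elements, so phi(z_i) is a multiple of
   some z_s(i), and then conjugation by the z_j shows that phi(x_i), phi(y_i) have
   opposite weights k e_s(i), - k e_s(i).  Comparing leading and lowest exponents
   in phi(y_i) phi(x_i), which is affine in z_s(i), gives |k| = 1 and the result.
   Finally phi(t) generates the center K[t]. *)
Require Import Defs.
From HB Require Import structures.
From mathcomp Require Import all_boot all_order all_algebra all_fingroup.
From mathcomp Require Import finmap monalg.
From Stdlib Require Import ClassicalEpsilon.
Set Implicit Arguments. Unset Strict Implicit. Unset Printing Implicit Defensive.
Import Order.TTheory GRing.Theory Num.Theory.
Local Open Scope ring_scope.

(** * Twisted group algebras *)

(** [R] is given only by its universal property, so neither spanning nor independence of the ordered
    monomials is available for free. The torus then serves for more than independence. There [x_i]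
    is invertible, so an element of [x_i]-weight m > 0 can be divided by [x_i^m]; as exponents of
    [z] and [t] stay nonnegative on the image of [R], the quotient comes from [R] again. The
    obstacle is that [y_i] goes to a binomial: neither this division nor the comparison of extremal
    exponents for normal elements applies to it. Hence two embeddings of the same algebra are used,
    and in the second one [y_i] is the monomial; [z_i] only acquires the factor [q_i], so
    commutation with [z_i] means the same in both. That the [z_i] are permuted is a degree count:
    [z_j] is a product of some [phi(z_k)] and a central factor, it has degree 1 in the [z]
    variables, and each [phi(z_k)], not being central, has degree at least 1. A similar count bounds
    the weight of [phi(x_i)]: m factors [y_s] and m factors [x_s] already have [z_s]-degree m, while
    their product is affine in [z_s]. *)

Section Bicharacter.

Variables (K : fieldType) (G : zmodType).

(** A bimultiplicative map is a 2-cocycle: [chi h k * chi g (h + k) = chi g h * chi (g + h) k]. This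
    is exactly what associativity of the twisted product asks on monomials. *)
Record bicharacter := Bicharacter {
  bichar :> G -> G -> K;
  bicharDl : forall g h k, bichar (g + h) k = bichar g k * bichar h k;
  bicharDr : forall g h k, bichar g (h + k) = bichar g h * bichar g k;
  bichar_neq0 : forall g h, bichar g h != 0
}.

Lemma bichar0l (chi : bicharacter) h : chi 0 h = 1.
Proof.
by apply: (mulfI (bichar_neq0 chi 0 h)); rewrite mulr1 -bicharDl addr0.
Qed.

Lemma bichar0r (chi : bicharacter) h : chi h 0 = 1.
Proof.
by apply: (mulfI (bichar_neq0 chi h 0)); rewrite mulr1 -bicharDr addr0.
Qed.

End Bicharacter.

(* The operations are locked: otherwise unification unfolds them down to finite
   maps. *)
HB.lock Definition tzero (K : fieldType) (G : zmodType) : {malg K[G]} := 0.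
HB.lock Definition topp (K : fieldType) (G : zmodType) (u : {malg K[G]}) := - u.
HB.lock Definition tadd (K : fieldType) (G : zmodType) (u v : {malg K[G]}) :=
  u + v.
HB.lock Definition tscale (K : fieldType) (G : zmodType) (c : K)
  (u : {malg K[G]}) := c *: u.

(** [chi] is a phantom parameter that selects the product put on the common carrier of finite
    sums. *)
Definition tgalg (K : fieldType) (G : zmodType) (chi : bicharacter K G) :=
  {malg K[G]}.

HB.lock Definition tcoef (K : fieldType) (G : zmodType) (chi : bicharacter K G)
  (g : G) (u : tgalg chi) : K := (u : {malg K[G]})@_g.

Section TwistedGroupAlgebraModule.

Variables (K : fieldType) (G : zmodType) (chi : bicharacter K G).

HB.instance Definition _ := Choice.on (tgalg chi).

Let tE := (tzero.unlock, topp.unlock, tadd.unlock, tscale.unlock, tcoef.unlock).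

Fact taddA : associative (@tadd K G). Proof. by move=> u v w; rewrite !tE addrA. Qed.
Fact taddC : commutative (@tadd K G). Proof. by move=> u v; rewrite !tE addrC. Qed.
Fact tadd0 : left_id (@tzero K G) (@tadd K G).
Proof. by move=> u; rewrite !tE add0r. Qed.
Fact taddN : left_inverse (@tzero K G) (@topp K G) (@tadd K G).
Proof. by move=> u; rewrite !tE addNr. Qed.

HB.instance Definition _ :=
  GRing.isZmodule.Build (tgalg chi) taddA taddC tadd0 taddN.

Fact tscaleA a b u : tscale a (tscale b u) = tscale (a * b) u :> tgalg chi.
Proof. by rewrite !tE scalerA. Qed.
Fact tscale1 : left_id 1 (@tscale K G).
Proof. by move=> u; rewrite !tE scale1r. Qed.
Fact tscaleDr : right_distributive (@tscale K G) (@tadd K G).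
Proof. by move=> c u v; rewrite !tE scalerDr. Qed.
Fact tscaleDl u : {morph (@tscale K G)^~ u : a b / a + b >-> tadd a b}.
Proof. by move=> a b; rewrite !tE scalerDl. Qed.

HB.instance Definition _ := GRing.Zmodule_isLmodule.Build K (tgalg chi)
  tscaleA tscale1 tscaleDr tscaleDl.

Lemma tcoef_is_scalar g : scalar (@tcoef K G chi g).
Proof.
move=> c u v; rewrite -[c *: u + v]/(tadd (tscale c u) v).
by rewrite !tE mcoeffD mcoeffZ.
Qed.

HB.instance Definition _ g := GRing.isLinear.Build K (tgalg chi) K *%R
  (@tcoef K G chi g) (tcoef_is_scalar g).

Lemma tcoef0 g : tcoef g (0 : tgalg chi) = 0.
Proof. exact: linear0. Qed.

Lemma tcoefD g (u v : tgalg chi) : tcoef g (u + v) = tcoef g u + tcoef g v.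
Proof. exact: linearD. Qed.

Lemma tcoefZ g c (u : tgalg chi) : tcoef g (c *: u) = c * tcoef g u.
Proof. exact: linearZ. Qed.

Lemma tgalgP (u v : tgalg chi) : (forall g, tcoef g u = tcoef g v) -> u = v.
Proof. by move=> E; apply/malgP => g; have := E g; rewrite !tE. Qed.

Lemma tcoef_neq0 (u : tgalg chi) g : (tcoef g u != 0) = (g \in msupp u).
Proof. by rewrite !tE mcoeff_neq0. Qed.

Lemma tcoef_outdom (u : tgalg chi) g : g \notin msupp u -> tcoef g u = 0.
Proof. by rewrite -tcoef_neq0 negbK => /eqP. Qed.

End TwistedGroupAlgebraModule.

HB.lock Definition tmon (K : fieldType) (G : zmodType) (chi : bicharacter K G)
  (g : G) : tgalg chi := << g >>.

Section TwistedGroupAlgebra.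

Variables (K : fieldType) (G : zmodType) (chi : bicharacter K G).
Local Notation tmon := (@tmon K G chi).
Implicit Types (u v w : tgalg chi) (g h : G).

Lemma tcoef_tmon g h : tcoef h (tmon g) = (g == h)%:R.
Proof. by rewrite tcoef.unlock tmon.unlock mcoeffU. Qed.

Lemma tcoefZtmon (c : K) g h : tcoef h (c *: tmon g) = c * (g == h)%:R.
Proof. by rewrite tcoefZ tcoef_tmon. Qed.

Lemma tgalgE u : u = \sum_(g <- msupp u) tcoef g u *: tmon g.
Proof.
apply: tgalgP => h; rewrite linear_sum /=.
have [hu|/[dup] hu /tcoef_outdom->] := boolP (h \in msupp u).
  rewrite (big_fsetD1 h) //= tcoefZtmon eqxx mulr1 big1_seq ?addr0 // => g.
  by rewrite in_fsetD1 tcoefZtmon => /andP[_ /andP[/negbTE-> _]]; rewrite mulr0.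
rewrite big1_seq // => g /andP[_ gu]; rewrite tcoefZtmon.
by case: (eqVneq g h) gu hu => [->->|]; rewrite ?mulr0.
Qed.

Lemma tgalg_ind (P : tgalg chi -> Prop) :
  P 0 -> (forall c g u, P u -> P (c *: tmon g + u)) -> forall u, P u.
Proof.
move=> P0 PD u; rewrite [u]tgalgE; elim: (X in \sum_(g <- X) _) => [|g s IH].
  by rewrite big_nil.
by rewrite big_cons; apply: PD.
Qed.

(** The universal property of the free module on the monomials; the twisted product applies it in
    each factor. *)
Definition tlift (V : lmodType K) (f : G -> V) u : V :=
  \sum_(g <- msupp u) tcoef g u *: f g.

Lemma tliftEw (V : lmodType K) (f : G -> V) (d : {fset G}) u :
  (msupp u `<=` d)%fset -> tlift f u = \sum_(g <- d) tcoef g u *: f g.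
Proof.
by move=> le_ud; apply: big_fset_incl => // g _ /tcoef_outdom->; rewrite scale0r.
Qed.

Lemma tlift_is_linear (V : lmodType K) (f : G -> V) : linear (tlift f).
Proof.
move=> c u v.
pose d := (msupp u `|` msupp v `|` msupp (c *: u + v))%fset.
rewrite !(@tliftEw _ _ d) ?fsubsetUr //; first last.
- by apply: fsubset_trans (fsubsetUl _ _); exact: fsubsetUl.
- by apply: fsubset_trans (fsubsetUl _ _); exact: fsubsetUr.
rewrite scaler_sumr -big_split /=; apply: eq_bigr => g _.
by rewrite linearP scalerDl scalerA.
Qed.

HB.instance Definition _ (V : lmodType K) (f : G -> V) :=
  GRing.isLinear.Build K (tgalg chi) V *:%R (@tlift V f) (@tlift_is_linear V f).

Lemma tlift_tmon (V : lmodType K) (f : G -> V) g : tlift f (tmon g) = f g.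
Proof.
rewrite (@tliftEw _ _ [fset g]%fset); last by rewrite tmon.unlock msuppU_le.
by rewrite big_seq_fset1 tcoef_tmon eqxx scale1r.
Qed.

Definition tmul u v : tgalg chi :=
  tlift (fun g => tlift (fun h => chi g h *: tmon (g + h)) v) u.

Lemma tmulDl : left_distributive tmul +%R.
Proof. by move=> u v w; rewrite /tmul linearD. Qed.

Lemma tmulZl c u v : tmul (c *: u) v = c *: tmul u v.
Proof. by rewrite /tmul linearZ. Qed.

Lemma tmulDr : right_distributive tmul +%R.
Proof.
move=> u v w; rewrite /tmul -big_split; apply: eq_bigr => g _.
by rewrite linearD scalerDr.
Qed.

Lemma tmulZr c u v : tmul u (c *: v) = c *: tmul u v.
Proof.
rewrite /tmul scaler_sumr; apply: eq_bigr => g _.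
by rewrite linearZ /= !scalerA mulrC.
Qed.

Lemma tmul0l v : tmul 0 v = 0.
Proof. by rewrite /tmul linear0. Qed.

Lemma tmul0r v : tmul v 0 = 0.
Proof. by have := tmulZr 0 v 0; rewrite !scale0r. Qed.

Lemma tmul_tmon g h : tmul (tmon g) (tmon h) = chi g h *: tmon (g + h).
Proof. by rewrite /tmul !tlift_tmon. Qed.

Lemma tmulA : associative tmul.
Proof.
move=> u v w; elim/tgalg_ind: u => [|a g u IHu]; first by rewrite !tmul0l.
rewrite !tmulDl !tmulZl IHu.
suff -> : tmul (tmon g) (tmul v w) = tmul (tmul (tmon g) v) w by [].
elim/tgalg_ind: v {IHu} => [|b h v IHv]; first by rewrite tmul0l !tmul0r tmul0l.
rewrite tmulDl !tmulDr tmulDl IHv tmulZl !tmulZr tmulZl.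
suff -> : tmul (tmon g) (tmul (tmon h) w) = tmul (tmul (tmon g) (tmon h)) w by [].
elim/tgalg_ind: w {IHv} => [|c k w IHw]; first by rewrite !tmul0r.
rewrite !tmulDr IHw !tmulZr.
rewrite !tmul_tmon !tmulZl tmulZr !tmul_tmon !scalerA addrA bicharDl bicharDr.
by rewrite -!mulrA [chi h k * _]mulrC -!mulrA.
Qed.

Lemma tmul1l : left_id (tmon 0) tmul.
Proof.
move=> u; elim/tgalg_ind: u => [|c g u IH]; first by rewrite tmul0r.
by rewrite tmulDr tmulZr tmul_tmon bichar0l scale1r add0r IH.
Qed.

Lemma tmul1r : right_id (tmon 0) tmul.
Proof.
move=> u; elim/tgalg_ind: u => [|c g u IH]; first by rewrite tmul0l.
by rewrite tmulDl tmulZl tmul_tmon bichar0r scale1r addr0 IH.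
Qed.

Lemma tmon_neq0 g : tmon g != 0.
Proof.
apply/eqP => /(congr1 (tcoef g)) /eqP.
by rewrite linear0 tcoef_tmon eqxx oner_eq0.
Qed.

HB.instance Definition _ := GRing.Zmodule_isNzRing.Build (tgalg chi)
  tmulA tmul1l tmul1r tmulDl tmulDr (tmon_neq0 0).

Lemma tgalg_scalerAl (a : K) u v : a *: (u * v) = (a *: u) * v.
Proof. exact/esym/tmulZl. Qed.

HB.instance Definition _ :=
  GRing.Lmodule_isLalgebra.Build K (tgalg chi) tgalg_scalerAl.

Lemma tgalg_scalerAr (a : K) u v : a *: (u * v) = u * (a *: v).
Proof. exact/esym/tmulZr. Qed.

HB.instance Definition _ :=
  GRing.Lalgebra_isAlgebra.Build K (tgalg chi) tgalg_scalerAr.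

Lemma tmonM g h : tmon g * tmon h = chi g h *: tmon (g + h).
Proof. exact: tmul_tmon. Qed.

Lemma tmon0 : tmon 0 = 1.
Proof. by []. Qed.

Lemma tcoefM_tmon u g h : tcoef (g + h) (u * tmon h) = tcoef g u * chi g h.
Proof.
elim/tgalg_ind: u => [|c k u IH]; first by rewrite mul0r !tcoef0 mul0r.
rewrite mulrDl !tcoefD IH mulrDl; congr (_ + _).
rewrite -scalerAl tmonM !tcoefZ !tcoef_tmon (inj_eq (addIr h)).
by case: eqP => [->|]; rewrite ?(mulr1, mulr0, mul0r).
Qed.

Lemma tcoef_tmonM u g h : tcoef (g + h) (tmon h * u) = tcoef g u * chi h g.
Proof.
elim/tgalg_ind: u => [|c k u IH]; first by rewrite mulr0 !tcoef0 mul0r.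
rewrite mulrDr !tcoefD IH mulrDl; congr (_ + _).
rewrite -scalerAr tmonM !tcoefZ !tcoef_tmon addrC (inj_eq (addIr h)).
by case: eqP => [->|]; rewrite ?(mulr1, mulr0, mul0r).
Qed.

(** Multiplication by a monomial shifts exponents without mixing them, so the coefficients at
    [g + h] can be compared. All exponents of [u] thus see the same factor; weights are read off
    this way. *)
Lemma tmon_twist u g h c :
  u * tmon h = c *: (tmon h * u) -> tcoef g u != 0 -> chi g h = c * chi h g.
Proof.
move=> /(congr1 (tcoef (g + h))); rewrite tcoefZ tcoefM_tmon tcoef_tmonM.
by rewrite mulrCA => + nz => /(mulfI nz).
Qed.

Lemma tcoefM u v k :
  tcoef k (u * v) = \sum_(g <- msupp u) \sum_(h <- msupp v)
                 tcoef g u * tcoef h v * chi g h * (g + h == k)%:R.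
Proof.
transitivity (tcoef k (tmul u v)) => //.
rewrite /tmul {1}/tlift linear_sum /=; apply: eq_bigr => g _.
rewrite tcoefZ /tlift linear_sum mulr_sumr /=; apply: eq_bigr => h _.
by rewrite !tcoefZ tcoef_tmon !mulrA.
Qed.

Lemma tcoefM_neq0 u v k : tcoef k (u * v) != 0 ->
  exists g h, [/\ tcoef g u != 0, tcoef h v != 0 & k = g + h].
Proof.
rewrite tcoefM => nz.
have [/hasP[g gu /hasP[h hv /eqP gh]]|noab] :=
  boolP (has (fun g => has (fun h => g + h == k) (msupp v)) (msupp u)).
  by exists g, h; rewrite !tcoef_neq0.
case/negP: nz; apply/eqP; rewrite big1_seq // => g /andP[_ gu].
rewrite big1_seq // => h /andP[_ hv].
case: eqP => gh; last by rewrite mulr0.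
by case/hasP: noab; exists g => //; apply/hasP; exists h => //; apply/eqP.
Qed.

(** * Extremal exponents for a translation-invariant total order *)

Section Lead.

Variable pos : pred G.
Hypothesis pos0 : pos 0 = false.
Hypothesis posD : forall g h, pos g -> pos h -> pos (g + h).
Hypothesis pos_total : forall g, [|| g == 0, pos g | pos (- g)].

(** [pos] is the positive cone of the order. Keeping it abstract lets the same lemmas serve the
    largest exponent ([lead]) and, with the opposite cone, the smallest one ([low]). *)
Definition is_lead u g :=
  tcoef g u != 0 /\ forall h, tcoef h u != 0 -> h = g \/ pos (g - h).

Lemma lead_neq0 u g : is_lead u g -> u != 0.
Proof. by case=> nz _; apply: contraNneq nz => ->; rewrite tcoef0. Qed.

Lemma pos_asym g : pos g -> pos (- g) = false.
Proof. by move=> pg; apply/negP => /(posD pg); rewrite subrr pos0. Qed.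

Lemma max_exists (s : seq G) : s != [::] ->
  exists2 g, g \in s & forall h, h \in s -> h = g \/ pos (g - h).
Proof.
elim: s => // a s IH _; have [->|/IH[g gs maxg]] := eqVneq s [::].
  by exists a => [|h]; rewrite mem_seq1 // => /eqP; left.
case/or3P: (pos_total (g - a)) => [/eqP/subr0_eq ga|ga|].
- exists g; first by rewrite inE gs orbT.
  by move=> h; rewrite inE ga => /predU1P[|/maxg]; rewrite ?ga; [left|].
- exists g; first by rewrite inE gs orbT.
  by move=> h; rewrite inE => /predU1P[->|/maxg//]; right.
- rewrite opprB => ag; exists a; first by rewrite inE eqxx.
  move=> h; rewrite inE => /predU1P[|/maxg[->|gh]]; [by left|by right|right].
  by have := posD ag gh; rewrite addrA subrK.
Qed.

Lemma lead_exists u : u != 0 -> exists g, is_lead u g.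
Proof.
move=> nz; have [|g gu maxg] := @max_exists (msupp u).
  apply: contraNneq nz => E; rewrite [u]tgalgE.
  by rewrite big1_seq // => g; rewrite E.
by exists g; split=> [|h]; rewrite tcoef_neq0 // => /maxg.
Qed.

Lemma lead_unique u g h : is_lead u g -> is_lead u h -> g = h.
Proof.
move=> [ug maxg] [uh maxh].
have [//|gh] := maxh _ ug; have [->//|hg] := maxg _ uh.
by have := pos_asym gh; rewrite opprB hg.
Qed.

Lemma lead_tmon g : is_lead (tmon g) g.
Proof.
split=> [|h]; rewrite tcoef_tmon ?eqxx ?oner_eq0 //.
by case: (eqVneq g h) => [->|_]; [left | rewrite eqxx].
Qed.

Lemma leadZ c u g : c != 0 -> is_lead u g -> is_lead (c *: u) g.
Proof.
move=> nz [ug maxg]; split=> [|h]; first by rewrite tcoefZ mulf_neq0.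
by rewrite tcoefZ mulf_eq0 negb_or => /andP[_ /maxg].
Qed.

(** The top terms cannot cancel: if a is at most [g], b at most [h] and a + b = [g + h], then a =
    [g] and b = [h], so a single product contributes to that coefficient. *)
Lemma leadM u v g h : is_lead u g -> is_lead v h -> is_lead (u * v) (g + h).
Proof.
move=> [ug maxg] [vh maxh]; split; last first.
  move=> k /tcoefM_neq0[a [b [/maxg au /maxh bv ->]]].
  case: au bv => [->|ga] [->|hb]; first by left.
  - by right; rewrite [g + h]addrC [g + b]addrC opprD addrACA subrr addr0.
  - by right; rewrite opprD addrACA subrr addr0.
  by right; rewrite opprD addrACA posD.
have eqgh a b : tcoef a u != 0 -> tcoef b v != 0 -> a + b = g + h -> a = g /\ b = h.
  move=> /maxg[->|ga] /maxh bv E; first by split=> //; apply: addrI E.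
  have E' : g - a = - (h - b).
    by apply/eqP; rewrite opprB subr_eq addrAC eq_sym subr_eq addrC E.
  case: bv => [bh|hb]; first by move: ga; rewrite E' bh subrr oppr0 pos0.
  by move: ga; rewrite E' pos_asym.
rewrite tcoefM (big_fsetD1 g) /=; last by rewrite -tcoef_neq0.
rewrite [X in X + _](big_fsetD1 h) /=; last by rewrite -tcoef_neq0.
rewrite eqxx mulr1 !big1_seq ?addr0 ?mulf_neq0 ?bichar_neq0 //.
- move=> a /andP[_]; rewrite in_fsetD1 -tcoef_neq0 => /andP[ag ua].
  rewrite big1_seq // => b /andP[_]; rewrite -tcoef_neq0 => vb.
  case: eqP => [/eqgh[]//|]; last by rewrite mulr0.
  by move=> E; rewrite E eqxx in ag.
- move=> b /andP[_]; rewrite in_fsetD1 -tcoef_neq0 => /andP[bh vb].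
  case: eqP => [/eqgh[]//|]; last by rewrite mulr0.
  by move=> _ E; rewrite E eqxx in bh.
Qed.

Lemma leadX u g m : is_lead u g -> is_lead (u ^+ m) (g *+ m).
Proof.
move=> ug; elim: m => [|m IH]; first by rewrite expr0 mulr0n; exact: lead_tmon.
by rewrite exprS mulrS; apply: leadM.
Qed.

Lemma tgalg_mulf_neq0 u v : u != 0 -> v != 0 -> u * v != 0.
Proof.
by move=> /lead_exists[g ug] /lead_exists[h vh]; apply: lead_neq0 (leadM ug vh).
Qed.

End Lead.

End TwistedGroupAlgebra.

(** * The lexicographic order on integer exponents *)

Section Lex.

Variable I : finType.
Implicit Types (g h : {ffun I -> int}) (s : seq I).

Fixpoint lex_pos_on s g :=
  if s is i :: s' then (0 < g i) || (g i == 0) && lex_pos_on s' g else false.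

Definition lex_pos g := lex_pos_on (enum I) g.

Lemma lex_pos0 : lex_pos 0 = false.
Proof. by rewrite /lex_pos; elim: (enum I) => //= i s ->; rewrite ffunE eqxx. Qed.

Lemma lex_posD g h : lex_pos g -> lex_pos h -> lex_pos (g + h).
Proof.
rewrite /lex_pos; elim: (enum I) => //= i s IH; rewrite ffunE.
case/orP=> [gi|/andP[/eqP-> gs]]; case/orP=> [hi|/andP[/eqP-> hs]].
- by rewrite addr_gt0.
- by rewrite addr0 gi.
- by rewrite add0r hi.
- by rewrite addr0 eqxx IH ?orbT.
Qed.

Lemma lex_pos_total g : [|| g == 0, lex_pos g | lex_pos (- g)].
Proof.
suff: [|| all (fun i => g i == 0) (enum I), lex_pos g | lex_pos (- g)].
  case/orP=> [/allP g0|->]; last by rewrite orbT.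
  by apply/orP; left; apply/eqP/ffunP => i; rewrite ffunE; apply/eqP/g0/mem_enum.
rewrite /lex_pos; elim: (enum I) => //= i s IH.
rewrite ffunE oppr_eq0 oppr_gt0.
by case: (ltgtP (g i) 0) IH => //= _; rewrite ?orbT.
Qed.

End Lex.

Section LexTwisted.

Variables (K : fieldType) (I : finType) (chi : bicharacter K {ffun I -> int}).
Implicit Types (u v : tgalg chi) (g h : {ffun I -> int}).

Definition lead u g := is_lead (@lex_pos I) u g.
Definition low u g := is_lead (fun h => lex_pos (- h)) u g.

Let pos0 := @lex_pos0 I.
Let posD := @lex_posD I.
Let pos_total := @lex_pos_total I.

Fact neg0 : lex_pos (- 0 : {ffun I -> int}) = false.
Proof. by rewrite oppr0 pos0. Qed.
Fact negD g h : lex_pos (- g) -> lex_pos (- h) -> lex_pos (- (g + h)).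
Proof. by rewrite opprD; apply: posD. Qed.
Fact neg_total g : [|| g == 0, lex_pos (- g) | lex_pos (- - g)].
Proof. by rewrite opprK [lex_pos (- g) || _]orbC pos_total. Qed.

Lemma tmul_neq0 u v : u != 0 -> v != 0 -> u * v != 0.
Proof. exact: tgalg_mulf_neq0 pos0 posD pos_total u v. Qed.

Lemma has_lead u : u != 0 -> exists g, lead u g.
Proof. exact: lead_exists posD pos_total u. Qed.

Lemma has_low u : u != 0 -> exists g, low u g.
Proof. exact: lead_exists negD neg_total u. Qed.

Lemma lead_mul u v g h : lead u g -> lead v h -> lead (u * v) (g + h).
Proof. exact: leadM pos0 posD u v g h. Qed.

Lemma low_mul u v g h : low u g -> low v h -> low (u * v) (g + h).
Proof. exact: leadM neg0 negD u v g h. Qed.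

Lemma lead_exp u g m : lead u g -> lead (u ^+ m) (g *+ m).
Proof. exact: leadX pos0 posD u g m. Qed.

Lemma lead_uniq u g h : lead u g -> lead u h -> g = h.
Proof. exact: lead_unique pos0 posD u g h. Qed.

Lemma low_uniq u g h : low u g -> low u h -> g = h.
Proof. exact: lead_unique neg0 negD u g h. Qed.

Lemma tmul_eq0 u v : u * v = 0 -> u = 0 \/ v = 0.
Proof.
move=> uv0; have [->|nzu] := eqVneq u 0; first by left.
have [->|nzv] := eqVneq v 0; first by right.
by have := tmul_neq0 nzu nzv; rewrite uv0 eqxx.
Qed.

(** Every exponent of [u] is squeezed between the smallest and the largest one, which coincide. *)
Lemma lead_low_tmon u g : lead u g -> low u g -> u = tcoef g u *: tmon chi g.
Proof.
move=> [_ maxg] [_ ming]; apply: tgalgP => h; rewrite tcoefZtmon.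
have [->|gh] := eqVneq g h; first by rewrite mulr1.
rewrite mulr0; apply: contraNeq gh => nz.
have [->//|p] := maxg _ nz; have [->//|] := ming _ nz.
by rewrite (pos_asym pos0 posD p).
Qed.

(* The extremal exponents of [v] are both [g]. *)
Lemma intertwine_tmon u v g : u != 0 -> u * tmon chi g = v * u ->
  exists c, v = c *: tmon chi g.
Proof.
move=> nzu E; have nzug := tmul_neq0 nzu (tmon_neq0 chi g).
have nzv : v != 0 by apply: contraNneq nzug => v0; rewrite E v0 mul0r.
exists (tcoef g v); apply: lead_low_tmon.
  have [[a ua] [b vb]] := (has_lead nzu, has_lead nzv).
  have := lead_mul vb ua; rewrite -E addrC => ab.
  by have /addrI -> := lead_uniq (lead_mul ua (lead_tmon _ _ g)) ab.
have [[a ua] [b vb]] := (has_low nzu, has_low nzv).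
have := low_mul vb ua; rewrite -E addrC => ab.
by have /addrI -> := low_uniq (low_mul ua (lead_tmon _ _ g)) ab.
Qed.

End LexTwisted.

(** * Commutation up to a scalar factor *)

Section QCommutation.

Variables (K : fieldType) (S : algType K).
Implicit Types (a b : K) (u v w : S).

Definition qcomm a u v := u * v = a *: (v * u).

Lemma qcommC a u v : a != 0 -> qcomm a u v -> qcomm a^-1 v u.
Proof. by move=> nz E; rewrite /qcomm E scalerA mulVf ?scale1r. Qed.

Lemma qcommMr a b u v w : qcomm a u v -> qcomm b u w -> qcomm (a * b) u (v * w).
Proof.
move=> Ev Ew; rewrite /qcomm mulrA Ev -scalerAl -[v * u * w]mulrA Ew -scalerAr scalerA.
by rewrite mulrA.
Qed.

Lemma qcommMl a b u v w : qcomm a u w -> qcomm b v w -> qcomm (a * b) (u * v) w.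
Proof.
move=> Eu Ev; rewrite /qcomm -[u * v * w]mulrA Ev -scalerAr [u * (w * v)]mulrA Eu -scalerAl scalerA.
by rewrite [b * a]mulrC mulrA.
Qed.

Lemma qcommDr a u v w : qcomm a u v -> qcomm a u w -> qcomm a u (v + w).
Proof. by move=> Ev Ew; rewrite /qcomm mulrDr Ev Ew mulrDl scalerDr. Qed.

Lemma qcommZr a b u v : qcomm a u v -> qcomm a u (b *: v).
Proof.
by move=> E; rewrite /qcomm -scalerAr E -scalerAl !scalerA mulrC.
Qed.

Lemma qcommZl a b u v : qcomm a u v -> qcomm a (b *: u) v.
Proof.
by move=> E; rewrite /qcomm -scalerAr -scalerAl E !scalerA mulrC.
Qed.

Lemma qcomm1r u : qcomm 1 u 1.
Proof. by rewrite /qcomm mulr1 mul1r scale1r. Qed.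

Lemma qcommXr a u v m : qcomm a u v -> qcomm (a ^+ m) u (v ^+ m).
Proof.
move=> E; elim: m => [|m IH]; first by rewrite !expr0; apply: qcomm1r.
by rewrite !exprS; apply: qcommMr.
Qed.

Lemma qcomm1P u v : qcomm 1 u v <-> u * v = v * u.
Proof. by rewrite /qcomm scale1r. Qed.

End QCommutation.

Section Bichar.

Variables (K : fieldType) (G : zmodType) (chi : bicharacter K G).

Lemma bicharNl g h : chi (- g) h = (chi g h)^-1.
Proof.
apply: (mulfI (bichar_neq0 chi g h)).
by rewrite -bicharDl subrr bichar0l mulfV ?bichar_neq0.
Qed.

Lemma bicharNr g h : chi g (- h) = (chi g h)^-1.
Proof.
apply: (mulfI (bichar_neq0 chi g h)).
by rewrite -bicharDr subrr bichar0r mulfV ?bichar_neq0.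
Qed.

Lemma bicharNN g h : chi (- g) (- h) = chi g h.
Proof. by rewrite bicharNl bicharNr invrK. Qed.

Lemma tmonC g h : qcomm (chi g h / chi h g) (tmon chi g) (tmon chi h).
Proof. by rewrite /qcomm !tmonM scalerA divfK ?bichar_neq0 // addrC. Qed.

End Bichar.

Definition ffdelta (I : finType) (a : I) : {ffun I -> int} :=
  [ffun b => (a == b)%:R].

(** * Bicharacters of a free abelian group, given by their values on a basis *)

Section MatrixBicharacter.

Variables (K : fieldType) (I : finType) (B : I -> I -> K).
Hypothesis B_neq0 : forall a b, B a b != 0.
Implicit Types g h k : {ffun I -> int}.

Definition mxbichar_fun g h := \prod_a \prod_b B a b ^ (g a * h b).

Fact mxbicharDl g h k :
  mxbichar_fun (g + h) k = mxbichar_fun g k * mxbichar_fun h k.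
Proof.
rewrite -big_split; apply: eq_bigr => a _; rewrite -big_split.
by apply: eq_bigr => b _ /=; rewrite ffunE mulrDl expfzDr.
Qed.

Fact mxbicharDr g h k :
  mxbichar_fun g (h + k) = mxbichar_fun g h * mxbichar_fun g k.
Proof.
rewrite -big_split; apply: eq_bigr => a _; rewrite -big_split.
by apply: eq_bigr => b _ /=; rewrite ffunE mulrDr expfzDr.
Qed.

Fact mxbichar_neq0 g h : mxbichar_fun g h != 0.
Proof. by apply/prodf_neq0 => a _; apply/prodf_neq0 => b _; rewrite expfz_neq0. Qed.

Definition mxbichar := Bicharacter mxbicharDl mxbicharDr mxbichar_neq0.

Lemma mxbichar_deltar g b : mxbichar g (ffdelta b) = \prod_a B a b ^ g a.
Proof.
apply: eq_bigr => a _; rewrite (bigD1 b) //= ffunE eqxx mulr1.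
rewrite big1 ?mulr1 // => c cb; rewrite ffunE eq_sym (negbTE cb) mulr0.
exact: expr0z.
Qed.

Lemma mxbichar_deltal a h : mxbichar (ffdelta a) h = \prod_b B a b ^ h b.
Proof.
rewrite /= /mxbichar_fun (bigD1 a) //= [X in _ * X]big1; last first.
  move=> c ca; rewrite big1 // => b _; rewrite ffunE eq_sym (negbTE ca) mul0r.
  exact: expr0z.
by rewrite mulr1; apply: eq_bigr => b _; rewrite ffunE eqxx mul1r.
Qed.

Lemma mxbichar_delta a b : mxbichar (ffdelta a) (ffdelta b) = B a b.
Proof.
rewrite mxbichar_deltar (bigD1 a) //= ffunE eqxx big1 ?mulr1 // => c ca.
by rewrite ffunE eq_sym (negbTE ca).
Qed.

End MatrixBicharacter.

(** * The quantum torus of the quantized Weyl algebra *)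

Section Relations.

Variables (K : fieldType) (n : nat) (q : 'I_n -> K) (lam : 'M[K]_n).
Hypothesis hpar : good_params q lam.
Variables (S : algType K) (x y : 'I_n -> S) (t : S).
Hypothesis hrel : Aqt_relations q lam x y t.

Lemma lamV i j : (lam i j)^-1 = lam j i.
Proof. by case: hpar => _ [_ [E _]]; rewrite [in RHS]E. Qed.

Lemma lam_neq0 i j : lam i j != 0.
Proof. by case: hpar => _ []. Qed.

Lemma q_neq0 i : q i != 0.
Proof. by case: hpar. Qed.

Lemma lamK i j : lam i j * lam j i = 1.
Proof. by rewrite -lamV mulVf ?lam_neq0. Qed.

Lemma relxx i j : i != j -> qcomm (lam i j) (x i) (x j).
Proof.
rewrite -val_eqE neq_ltn => /orP[/(hrel.1)[]//|/(hrel.1)[E _ _ _]].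
by rewrite -lamV; apply: qcommC E; apply: lam_neq0.
Qed.

Lemma relyy i j : i != j -> qcomm (lam i j) (y i) (y j).
Proof.
rewrite -val_eqE neq_ltn => /orP[/(hrel.1)[_ E _ _]|/(hrel.1)[]//].
by rewrite -lamV; apply: qcommC E; apply: lam_neq0.
Qed.

Lemma relxy i j : i != j -> qcomm (lam j i) (x i) (y j).
Proof. by rewrite -val_eqE neq_ltn => /orP[/(hrel.1)[]|/(hrel.1)[]]. Qed.

Lemma relyx i j : i != j -> qcomm (lam j i) (y i) (x j).
Proof.
move=> ij; rewrite -lamV; apply: qcommC; first exact: lam_neq0.
by apply: relxy; rewrite eq_sym.
Qed.

Lemma relxyi i : x i * y i = 1 + q i *: (y i * x i).
Proof. by have [_ [E _]] := hrel; rewrite -(E i) subrK. Qed.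

Lemma reltx i : t * x i = x i * t.
Proof. by have [_ [_ /(_ i)[]]] := hrel. Qed.

Lemma relty i : t * y i = y i * t.
Proof. by have [_ [_ /(_ i)[]]] := hrel. Qed.

(** By the relation between [x i] and [y i] this is the commutator [x i * y i - y i * x i]. *)
Definition zel i := 1 + (q i - 1) *: (y i * x i).

Lemma zel_x i j : qcomm (if i == j then q i else 1) (x i) (zel j).
Proof.
have [<-|ij] := eqVneq i j.
  rewrite /qcomm /zel mulrDl mulrDr mul1r mulr1 -scalerAr -scalerAl mulrA.
  rewrite relxyi mulrDl mul1r -scalerAl !scalerDr !scalerA addrA.
  by rewrite -{1}[x i]scale1r -scalerDl [1 + _]addrC subrK [q i * (_ - _)]mulrC.
apply: qcommDr; first exact: qcomm1r.
apply: qcommZr; rewrite -(lamK j i); apply: qcommMr; first exact: relxy.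
exact: relxx.
Qed.

Lemma zel_y i j : qcomm (if i == j then (q i)^-1 else 1) (y i) (zel j).
Proof.
have [<-|ij] := eqVneq i j.
  apply: qcommC; first exact: q_neq0.
  rewrite /qcomm /zel mulrDl mulrDr mul1r mulr1 -scalerAr -scalerAl -mulrA.
  rewrite relxyi mulrDr mulr1 -scalerAr !scalerDr !scalerA addrA.
  by rewrite -{1}[y i]scale1r -scalerDl [1 + _]addrC subrK [q i * (_ - _)]mulrC.
apply: qcommDr; first exact: qcomm1r.
apply: qcommZr; rewrite -(lamK i j); apply: qcommMr; first exact: relyy.
exact: relyx.
Qed.

End Relations.

Section WeylTorus.

Variables (K : fieldType) (n : nat) (q : 'I_n -> K) (lam : 'M[K]_n).
Hypothesis hpar : good_params q lam.
Hypothesis hq : no_root_of_unity q.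

(* [Some (i, false)], [Some (i, true)] and [None] are the exponents of [x i],
   [z i] and [t]. *)
Notation widx := (option ('I_n * bool)).

(** Only the quotient [chi g h / chi h g] governs commutation. Putting each factor on one side of
    the diagonal yields the prescribed quotients without square roots of the parameters. *)
Definition wmx (a b : widx) : K :=
  match a, b with
  | Some (i, false), Some (j, false) => if (i < j)%N then lam i j else 1
  | Some (i, false), Some (j, true) => if i == j then q i else 1
  | _, _ => 1
  end.

Fact wmx_neq0 a b : wmx a b != 0.
Proof.
case: a b => [[i []]|] [[j []]|] /=; rewrite ?oner_eq0 //.
  by case: ifP => _; rewrite ?oner_eq0 ?(q_neq0 hpar).
by case: ifP => _; rewrite ?oner_eq0 ?(lam_neq0 hpar).
Qed.

Local Notation chi := (mxbichar wmx_neq0).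
Local Notation wtorus := (tgalg chi).

Definition dx i : {ffun widx -> int} := ffdelta (Some (i, false)).
Definition dz i : {ffun widx -> int} := ffdelta (Some (i, true)).
Definition dt : {ffun widx -> int} := ffdelta None.

Definition wx i : wtorus := tmon chi (dx i).
Definition wxi i : wtorus := tmon chi (- dx i).
Definition wz i : wtorus := tmon chi (dz i).
Definition wt : wtorus := tmon chi dt.
Definition wy i : wtorus := (q i - 1)^-1 *: ((wz i - 1) * wxi i).

Lemma q_neq1 i : q i - 1 != 0.
Proof. by rewrite subr_eq0 -[q i]expr1 hq. Qed.

Lemma wxiK i : wx i * wxi i = 1.
Proof.
by rewrite /wx /wxi tmonM bicharNr mxbichar_delta /= ltnn invr1 scale1r subrr tmon0.
Qed.

Lemma wxKi i : wxi i * wx i = 1.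
Proof.
by rewrite /wx /wxi tmonM bicharNl mxbichar_delta /= ltnn invr1 scale1r addNr tmon0.
Qed.

Lemma wz_zel i : zel q wx wy i = wz i.
Proof.
rewrite /zel /wy -scalerAl scalerA mulfV ?q_neq1 // scale1r -mulrA wxKi mulr1.
by rewrite addrC subrK.
Qed.

Let wxx i j : i != j -> qcomm (lam i j) (wx i) (wx j).
Proof.
move=> ij; have := tmonC chi (dx i) (dx j); rewrite !mxbichar_delta /=.
move: ij; rewrite -val_eqE neq_ltn; case: ltngtP => //= _ _.
  by rewrite divr1.
by rewrite div1r (lamV hpar).
Qed.

Let wxx' i j : i != j -> qcomm (lam j i) (wx i) (wxi j).
Proof.
move=> ij; have := tmonC chi (dx i) (- dx j).
rewrite bicharNl bicharNr !mxbichar_delta /=.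
move: ij; rewrite -val_eqE neq_ltn; case: ltngtP => //= _ _.
  by rewrite invr1 divr1 (lamV hpar).
by rewrite invr1 div1r invrK.
Qed.

Let wx'x' i j : i != j -> qcomm (lam i j) (wxi i) (wxi j).
Proof.
move=> ij; have := tmonC chi (- dx i) (- dx j).
rewrite (bicharNN _ (dx i) (dx j)) (bicharNN _ (dx j) (dx i)) !mxbichar_delta /=.
move: ij; rewrite -val_eqE neq_ltn; case: ltngtP => //= _ _.
  by rewrite divr1.
by rewrite div1r (lamV hpar).
Qed.

Let wxz i j : qcomm (if i == j then q i else 1) (wx i) (wz j).
Proof. by have := tmonC chi (dx i) (dz j); rewrite !mxbichar_delta /= divr1. Qed.

Let wx'z i j : i != j -> qcomm 1 (wxi i) (wz j).
Proof.
move=> /negbTE ij; have := tmonC chi (- dx i) (dz j).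
by rewrite bicharNl bicharNr !mxbichar_delta /= ij !invr1 mulr1.
Qed.

Let wzz i j : qcomm 1 (wz i) (wz j).
Proof. by have := tmonC chi (dz i) (dz j); rewrite !mxbichar_delta /= divr1. Qed.

Let qcommN1 a (u v : wtorus) : qcomm 1 u v -> qcomm 1 u (v - a%:A).
Proof.
move=> uv; apply: qcommDr => //; rewrite -scaleNr.
by apply: qcommZr; apply: qcomm1r.
Qed.

Let wxy i j : i != j -> qcomm (lam j i) (wx i) (wy j).
Proof.
(* The unit is written as [1 *: 1] to fit the form [a%:A] in [qcommN1]. *)
move=> ij; apply: qcommZr; rewrite -[lam j i]mul1r -(scale1r 1).
apply: qcommMr; last exact: wxx'.
by apply: qcommN1; have := wxz i j; rewrite (negbTE ij).
Qed.

Let wyy i j : i != j -> qcomm (lam i j) (wy i) (wy j).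
Proof.
move=> ij; have ji : j != i by rewrite eq_sym.
apply: qcommZr; rewrite -[lam i j]mul1r.
apply: qcommMr; last first.
  apply: qcommZl; rewrite -[lam i j]mul1r.
  apply: qcommMl; last exact: wx'x'.
  rewrite -[X in qcomm X]invr1; apply: qcommC; first exact: oner_neq0.
  by rewrite -(scale1r 1); apply: qcommN1; apply: wx'z.
apply: qcommZl; rewrite -[X in qcomm X]mulr1.
rewrite -(scale1r 1); apply: qcommMl; apply: qcommN1; last exact: wx'z.
rewrite -[X in qcomm X]invr1; apply: qcommC; first exact: oner_neq0.
by apply: qcommN1.
Qed.

Lemma wtorus_rel : Aqt_relations q lam wx wy wt.
Proof.
split=> [i j ij|]; last split=> i.
- have nij : i != j by rewrite -val_eqE neq_ltn ij.
  have nji : j != i by rewrite eq_sym.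
  by split; [apply: wxx | apply: wyy | apply: wxy | apply: wxy].
- rewrite /wy -scalerAl -scalerAr -[in X in _ - X]mulrA wxKi mulr1.
  rewrite mulrA mulrBr mulr1 mulrBl.
  have := wxz i i; rewrite eqxx => ->.
  rewrite wxiK -scalerAl -mulrA wxiK mulr1 scalerA mulrC -scalerA -scalerBr.
  rewrite (scalerBr (q i)) opprB addrAC [q i *: _ + (_ - _)]addrC subrK -{2}(scale1r 1).
  by rewrite -scalerBl scalerA mulVf ?scale1r ?q_neq1.
- split; apply/qcomm1P.
    by have := tmonC chi dt (dx i); rewrite !mxbichar_delta /= divr1.
  apply: qcommZr; rewrite -[X in qcomm X](mulr1 1) -(scale1r 1).
  apply: qcommMr; first apply: qcommN1.
    by have := tmonC chi dt (dz i); rewrite !mxbichar_delta /= divr1.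
  have := tmonC chi dt (- dx i).
  by rewrite bicharNl bicharNr !mxbichar_delta /= !invr1 mulr1.
Qed.

(** Among all factors of the twist only [q i] involves [z_i], so conjugation by [z_i] measures the
    exponent of [x_i]. *)
Lemma wchi_z (g : {ffun widx -> int}) i : chi g (dz i) / chi (dz i) g = q i ^ g (Some (i, false)).
Proof.
rewrite mxbichar_deltar mxbichar_deltal [X in _ / X]big1 ?divr1; last first.
  by move=> b _ /=; apply: exp1rz.
rewrite (bigD1 (Some (i, false))) //= eqxx big1 ?mulr1 // => -[[j []]|] //=;
  rewrite ?exp1rz //.
by case: (eqVneq j i) => [->|]; rewrite ?eqxx ?exp1rz.
Qed.

(** The factors from [lam] need an [x] exponent on both sides; without one in [g], conjugation by
    [x_i] measures the exponent of [z_i] alone. *)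
Lemma wchi_x (g : {ffun widx -> int}) i : (forall j, g (Some (j, false)) = 0) ->
  chi g (dx i) / chi (dx i) g = q i ^ (- g (Some (i, true))).
Proof.
move=> g0; rewrite mxbichar_deltar mxbichar_deltal [X in X / _]big1; last first.
  by move=> [[j []]|] _ /=; rewrite ?exp1rz ?g0 ?expr0z.
rewrite div1r (bigD1 (Some (i, true))) //= eqxx big1 ?mulr1 ?invr_expz //.
move=> [[j []]|] //=; rewrite ?exp1rz ?g0 ?expr0z //.
by case: (eqVneq i j) => [->|]; rewrite ?eqxx ?exp1rz.
Qed.

(** [q i] has infinite order in the multiplicative group; this turns equal commutation factors into
    equal exponents. *)
Lemma q_expz_inj i (a b : int) : q i ^ a = q i ^ b -> a = b.
Proof.
suff inj k : q i ^ k = 1 -> k = 0.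
  move=> E; apply/eqP; rewrite -subr_eq0; apply/eqP/inj.
  by rewrite expfzDr ?(q_neq0 hpar) // E -expfzDr ?(q_neq0 hpar) // subrr expr0z.
case: k => [[|m]|m] //; rewrite ?NegzE => E; first by have := hq i (ltn0Sn m); rewrite -E eqxx.
have := hq i (ltn0Sn m); rewrite -[_ ^+ _]invrK.
by move: E; rewrite -invr_expz => /= ->; rewrite invr1 eqxx.
Qed.

End WeylTorus.

Notation wchi hpar := (mxbichar (wmx_neq0 hpar)).
Notation wtorus hpar := (tgalg (wchi hpar)).

(** * Generation, spanning monomials and the embedding *)

Section Subalgebra.

Variables (K : fieldType) (R : algType K) (P : {pred R}).
Hypothesis hP : subalg_closed P.

(** The vacuous [let] makes [hP] a parameter of the predicate, so that the closure instance can be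
    attached to it. *)
Definition subalg_pred : {pred R} := let _ := hP in P.

HB.instance Definition _ := GRing.isSubalgClosed.Build K R subalg_pred hP.

Record subalg := Subalg { subalg_val :> R; _ : subalg_val \in subalg_pred }.

HB.instance Definition _ := [isSub for subalg_val].
HB.instance Definition _ := [Choice of subalg by <:].
HB.instance Definition _ := [SubChoice_isSubAlgebra of subalg by <:].

Definition subalg_incl (u : subalg) : R := subalg_val u.

Fact subalg_incl_linear : linear subalg_incl. Proof. by []. Qed.
Fact subalg_incl_monoid : monoid_morphism subalg_incl. Proof. by []. Qed.

HB.instance Definition _ :=
  GRing.isLinear.Build K subalg R *:%R subalg_incl subalg_incl_linear.
HB.instance Definition _ :=
  GRing.isMonoidMorphism.Build subalg R subalg_incl subalg_incl_monoid.

End Subalgebra.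

(** The elements satisfying [P] form a subalgebra containing the generators. The universal property
    maps [R] into it, and by uniqueness this map followed by the inclusion is the identity. Excluded
    middle makes [P] a boolean predicate, as the subalgebra structure requires. *)
Lemma Aqt_ind (K : fieldType) (n : nat) (q : 'I_n -> K) (lam : 'M[K]_n)
    (R : algType K) (x y : 'I_n -> R) (t : R) (P : R -> Prop) :
  is_Aqt q lam x y t ->
  P 1 -> (forall c u v, P u -> P v -> P (c *: u + v)) ->
  (forall u v, P u -> P v -> P (u * v)) ->
  (forall i, P (x i)) -> (forall i, P (y i)) -> P t ->
  forall r, P r.
Proof.
move=> [hrel huniv] P1 PL PM Px Py Pt.
pose p : {pred R} := fun r => if excluded_middle_informative (P r) then true else false.
have pP r : reflect (P r) (r \in p).
  by rewrite /in_mem /= /p; case: excluded_middle_informative => ?; constructor.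
have pA : subalg_closed p.
  split=> [|c u v /pP Pu /pP Pv|u v /pP Pu /pP Pv]; first exact/pP.
    exact/pP/PL.
  exact/pP/PM.
pose S := subalg pA.
have mem r : P r -> r \in subalg_pred pA by move/pP.
pose X i : S := Subalg (mem _ (Px i)); pose Y i : S := Subalg (mem _ (Py i)).
pose T : S := Subalg (mem _ Pt).
have hS : Aqt_relations q lam X Y T.
  case: hrel => h1 [h2 h3]; split=> [i j /h1[E1 E2 E3 E4]|].
    by split; apply: val_inj.
  by split=> i; [apply/val_inj/h2 | have [? ?] := h3 i; split; apply: val_inj].
have [[f [fxy ft]] _] := huniv S X Y T hS.
pose h : {lrmorphism R -> R} := @subalg_incl K R p pA \o f.
have [_ /(_ h idfun)] := huniv R x y t hrel.
move=> /= U r; suff <- : h r = r by apply/pP/(valP (f r)).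
apply: U => //= [i|]; last by rewrite ft.
by have [-> ->] := fxy i.
Qed.

Section OrderedProducts.

Variables (K : fieldType) (S : algType K) (I : eqType) (u : I -> S).
Implicit Types (s : seq I) (a : I -> nat).

Lemma qcomm_prod v s a :
  (forall i, i \in s -> exists c, qcomm c v (u i)) ->
  exists c : K, qcomm c v (\prod_(i <- s) u i ^+ a i).
Proof.
elim: s => [|i s IH] vu; first by exists 1; rewrite big_nil; apply: qcomm1r.
have [|c Ec] := IH; first by move=> k ks; apply: vu; rewrite inE ks orbT.
have [|b Eb] := vu i; first by rewrite mem_head.
by exists (b ^+ a i * c); rewrite big_cons; apply: qcommMr => //; apply: qcommXr.
Qed.

(** Moving [u j] to its place passes only factors that commute with it up to a scalar. *)
Lemma prod_insert s a j : uniq s -> j \in s ->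
  (forall i, i != j -> exists c, qcomm c (u j) (u i)) ->
  exists c : K, u j * (\prod_(i <- s) u i ^+ a i)
                = c *: \prod_(i <- s) u i ^+ (a i + (i == j)).
Proof.
move=> + + uu; elim: s => // i s IH /=; rewrite inE => /andP[nis us].
have [-> _|ij /= js] := eqVneq j i.
  exists 1; rewrite scale1r !big_cons eqxx addn1 exprS -mulrA; congr (_ * (_ * _)).
  apply: eq_big_seq => k ks; case: eqP => [E|]; last by rewrite addn0.
  by rewrite -E ks in nis.
have [c E] := IH us js; have [|b /(@qcommXr _ _ _ _ _ (a i)) Eb] := uu i; first by rewrite eq_sym.
exists (b ^+ a i * c); rewrite !big_cons mulrA Eb -scalerAl -mulrA E -scalerAr scalerA.
by rewrite eq_sym (negbTE ij) addn0.
Qed.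

End OrderedProducts.

Section Spanning.

Variables (K : fieldType) (n : nat) (q : 'I_n -> K) (lam : 'M[K]_n).
Hypothesis hpar : good_params q lam.
Variables (R : algType K) (x y : 'I_n -> R) (t : R).
Hypothesis hR : is_Aqt q lam x y t.

Notation pbw_index := ({ffun 'I_n -> nat} * {ffun 'I_n -> nat} * nat)%type.

Definition pbw (m : pbw_index) : R :=
  (\prod_i y i ^+ m.1.1 i) * (\prod_i x i ^+ m.1.2 i) * t ^+ m.2.

Definition pbw_span (r : R) :=
  exists s : seq (K * pbw_index), r = \sum_(p <- s) p.1 *: pbw p.2.

Lemma pbw_spanP c u v : pbw_span u -> pbw_span v -> pbw_span (c *: u + v).
Proof.
move=> [s ->] [s' ->]; exists ([seq (c * p.1, p.2) | p <- s] ++ s').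
rewrite big_cat big_map scaler_sumr; congr (_ + _).
by apply: eq_bigr => p _; rewrite scalerA.
Qed.

Lemma pbw_span0 : pbw_span 0.
Proof. by exists [::]; rewrite big_nil. Qed.

Lemma pbw_spanZ c u : pbw_span u -> pbw_span (c *: u).
Proof. by move=> /(pbw_spanP c)/(_ pbw_span0); rewrite addr0. Qed.

Lemma pbw_span_pbw m : pbw_span (pbw m).
Proof. by exists [:: (1, m)]; rewrite big_seq1 scale1r. Qed.

Lemma pbw_span_mull u : (forall m, pbw_span (u * pbw m)) ->
  forall v, pbw_span v -> pbw_span (u * v).
Proof.
move=> um v [s ->]; elim: s => [|p s IH]; first by rewrite big_nil mulr0; apply: pbw_span0.
by rewrite big_cons mulrDr -scalerAr; apply: pbw_spanP.
Qed.

Let hrel := hR.1.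

Let shift (a : {ffun 'I_n -> nat}) (j : 'I_n) : {ffun 'I_n -> nat} :=
  [ffun i => (a i + (i == j))%N].

Let prod_shift (w : 'I_n -> R) (a : {ffun 'I_n -> nat}) j :
  \prod_i w i ^+ (a i + (i == j)) = \prod_i w i ^+ shift a j i.
Proof. by apply: eq_bigr => i _; rewrite ffunE. Qed.

Lemma pbw_mul_y j m : pbw_span (y j * pbw m).
Proof.
have [|i ij|c E] := @prod_insert _ _ _ y (index_enum _) m.1.1 j (index_enum_uniq _).
- by rewrite mem_index_enum.
- by exists (lam j i); apply: (relyy hpar hrel); rewrite // eq_sym.
rewrite /pbw !mulrA E prod_shift -!scalerAl; apply: pbw_spanZ.
exact: (pbw_span_pbw (shift m.1.1 j, m.1.2, m.2)).
Qed.

Lemma pbw_mul_t m : pbw_span (t * pbw m).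
Proof.
have ct (w : 'I_n -> R) (a : 'I_n -> nat) : (forall i, t * w i = w i * t) ->
    t * (\prod_i w i ^+ a i) = (\prod_i w i ^+ a i) * t.
  move=> tw; elim/big_ind: _ => [|u v Eu Ev|i _]; first by rewrite mulr1 mul1r.
    by rewrite mulrA Eu -mulrA Ev mulrA.
  exact/commrX/tw.
rewrite /pbw !mulrA ct; last by move=> i; apply: (relty hrel).
rewrite -[_ * t * _]mulrA ct; last by move=> i; apply: (reltx hrel).
rewrite mulrA -mulrA -exprS.
exact: (pbw_span_pbw (m.1.1, m.1.2, m.2.+1)).
Qed.

(** The scalar [c] is the q-integer 1 + q + ... + q^(m-1), built by the recursion [1 + q j * c]. The
    clause for [m = 0] is needed in the induction because [m.-1] is then 0 and the last power is
    1. *)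
Lemma mul_x_yexp j m : exists c : K, (m = 0%N -> c = 0) /\
  x j * y j ^+ m = q j ^+ m *: (y j ^+ m * x j) + c *: y j ^+ m.-1.
Proof.
elim: m => [|m [c [c0 IH]]]; first by exists 0; rewrite !expr0 mulr1 mul1r scale1r scale0r addr0.
exists (1 + q j * c); split=> //=.
rewrite [in LHS]exprS mulrA (relxyi hrel) mulrDl mul1r -scalerAl.
rewrite -[y j * x j * _]mulrA IH mulrDr -!scalerAr [y j * (_ * _)]mulrA -exprS.
rewrite scalerDr !scalerA -exprS addrCA scalerDl scale1r; congr (_ + (_ + _)).
case: m c0 {IH} => [->//|m _]; first by rewrite mulr0 !scale0r.
by rewrite -exprS.
Qed.

(** Only the factor with index [j] produces an extra term, with its exponent lowered by one. For
    exponent 0 the truncated subtraction is harmless: the result is used only as a combination of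
    ordered products. *)
Lemma mul_x_yprod j s (a : {ffun 'I_n -> nat}) : uniq s ->
  exists c c' : K, x j * (\prod_(i <- s) y i ^+ a i) =
    c *: ((\prod_(i <- s) y i ^+ a i) * x j)
    + c' *: \prod_(i <- s) y i ^+ (a i - (i == j)).
Proof.
elim: s => [_|i s IH /= /andP[nis us]].
  by exists 1, 0; rewrite !big_nil mulr1 mul1r scale1r scale0r addr0.
have [ij|ij] := eqVneq i j; last first.
  have [c [c' E]] := IH us.
  have /(qcommXr (a i)) Eb : qcomm (lam i j) (x j) (y i).
    have ji : j != i by rewrite eq_sym.
    exact (relxy hrel ji).
  exists (lam i j ^+ a i * c), (lam i j ^+ a i * c').
  rewrite !big_cons mulrA Eb -scalerAl -[_ * x j * _]mulrA E mulrDr -!scalerAr scalerDr !scalerA.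
  by rewrite (negbTE ij) subn0 mulrA.
have [c1 Ec1] : exists c : K, qcomm c (x j) (\prod_(i <- s) y i ^+ a i).
  apply: qcomm_prod => k ks; exists (lam k j); apply: (relxy hrel) => //.
  by apply: contraTneq ks => <-; rewrite -ij.
have [c [_ E]] := mul_x_yexp j (a i).
exists (q j ^+ a i * c1), c; rewrite !big_cons mulrA ij in E *.
rewrite E mulrDl -!scalerAl -[_ * x j * _]mulrA Ec1 -scalerAr scalerA eqxx subn1 mulrA.
congr (_ + _ *: (_ * _)); apply: eq_big_seq => k ks.
case: eqP => [kj|]; last by rewrite subn0.
by rewrite -ij in kj; rewrite -kj ks in nis.
Qed.

Lemma pbw_mul_x j m : pbw_span (x j * pbw m).
Proof.
have [c [c' E]] := @mul_x_yprod j (index_enum _) m.1.1 (index_enum_uniq _).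
have [|i ij|b Eb] := @prod_insert _ _ _ x (index_enum _) m.1.2 j (index_enum_uniq _).
- by rewrite mem_index_enum.
- by exists (lam j i); apply: (relxx hpar hrel); rewrite // eq_sym.
rewrite /pbw !mulrA E !mulrDl -!scalerAl -[_ * x j * _]mulrA Eb -scalerAr -scalerAl.
rewrite prod_shift; apply: pbw_spanP; first apply: pbw_spanZ.
  exact: (pbw_span_pbw (m.1.1, shift m.1.2 j, m.2)).
apply: pbw_spanZ; pose a := [ffun i => (m.1.1 i - (i == j))%N].
rewrite (eq_bigr (fun i => y i ^+ a i)); last by move=> i _; rewrite ffunE.
exact: (pbw_span_pbw (a, m.1.2, m.2)).
Qed.

Lemma pbw_spanT r : pbw_span r.
Proof.
have sp1 : pbw_span 1.
  have -> : 1 = pbw ([ffun=> 0%N], [ffun=> 0%N], 0%N).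
    by rewrite /pbw expr0 mulr1 !big1 ?mulr1 // => i _; rewrite ffunE.
  exact: pbw_span_pbw.
(* Stability of the span under left multiplication by [r] passes to sums and products of such [r],
   unlike membership in the span, for which products are not immediate. *)
suff H : forall u, pbw_span u -> pbw_span (r * u) by have := H _ sp1; rewrite mulr1.
move: r; apply: (Aqt_ind hR).
- by move=> u; rewrite mul1r.
- move=> c u v Pu Pv w Sw; rewrite mulrDl -scalerAl.
  by apply: pbw_spanP; [apply: Pu | apply: Pv].
- by move=> u v Pu Pv w Sw; rewrite -mulrA; apply/Pu/Pv.
- by move=> i; apply: pbw_span_mull; apply: pbw_mul_x.
- by move=> i; apply: pbw_span_mull; apply: pbw_mul_y.
- by apply: pbw_span_mull; apply: pbw_mul_t.
Qed.

(** Equal monomials are merged, so that a leading exponent is later met only once. *)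
Lemma pbw_span_uniq r : exists (s : seq pbw_index) (C : pbw_index -> K),
  uniq s /\ r = \sum_(m <- s) C m *: pbw m.
Proof.
have [s ->] := pbw_spanT r.
exists (undup [seq p.2 | p <- s]), (fun m => \sum_(p <- s | p.2 == m) p.1).
split; first exact: undup_uniq.
under [RHS]eq_bigr do rewrite scaler_suml big_mkcond.
rewrite [RHS]exchange_big /= big_seq [RHS]big_seq; apply: eq_bigr => p ps.
rewrite -big_mkcond (big_rem p.2) /=; last by rewrite mem_undup map_f.
rewrite eqxx big1_seq ?addr0 // => m /andP[/eqP <-].
by rewrite mem_rem_uniq ?undup_uniq // inE eqxx.
Qed.

End Spanning.

Lemma lex_pos_nneg (I : finType) (g : {ffun I -> int}) :
  (forall a, 0 <= g a) -> lex_pos (- g) = false.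
Proof.
move=> g0; rewrite /lex_pos; elim: (enum I) => //= a s ->.
by rewrite ffunE oppr_gt0 ltNge g0 andbF.
Qed.

Lemma lex_pos_delta (I : finType) (a : I) : lex_pos (ffdelta a).
Proof.
case/or3P: (lex_pos_total (ffdelta a)) => [/eqP/ffunP/(_ a)|//|].
  by rewrite !ffunE eqxx.
by rewrite lex_pos_nneg // => b; rewrite ffunE ler0n.
Qed.

(** * Extremal exponents of affine elements and of ordered monomials *)

Section AffineLead.

Variables (K : fieldType) (I : finType) (chi : bicharacter K {ffun I -> int}).
Variables (a : I) (A B : K).
Hypotheses (A0 : A != 0) (B0 : B != 0).

Local Notation u := (A *: tmon chi (ffdelta a) + B%:A).

Let ucoef g : tcoef g u = A * (ffdelta a == g)%:R + B * (0 == g)%:R.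
Proof. by rewrite tcoefD tcoefZ tcoef_tmon tcoefZ -tmon0 tcoef_tmon. Qed.

Let delta_neq0 : (ffdelta a == 0) = false.
Proof. by apply: contraTF (lex_pos_delta a) => /eqP->; rewrite lex_pos0. Qed.

Lemma lead_affine : lead u (ffdelta a).
Proof.
split=> [|h]; first by rewrite ucoef eqxx [0 == _]eq_sym delta_neq0 mulr0 addr0 mulr1.
rewrite ucoef; have [->|_] := eqVneq (ffdelta a) h; first by left.
have [<- _|_] := eqVneq 0 h; first by right; rewrite subr0 lex_pos_delta.
by rewrite !mulr0 addr0 eqxx.
Qed.

Lemma low_affine : low u 0.
Proof.
split=> [|h]; first by rewrite ucoef eqxx delta_neq0 mulr0 add0r mulr1.
rewrite ucoef; have [<- _|_] := eqVneq (ffdelta a) h.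
  by right; rewrite opprB subr0 lex_pos_delta.
have [<- _|_] := eqVneq 0 h; first by left.
by rewrite !mulr0 addr0 eqxx.
Qed.

End AffineLead.

Lemma lead_prod (K : fieldType) (I : finType)
    (chi : bicharacter K {ffun I -> int}) (J : Type) (s : seq J)
    (u : J -> tgalg chi) (g : J -> {ffun I -> int}) :
  (forall j, lead (u j) (g j)) -> lead (\prod_(j <- s) u j) (\sum_(j <- s) g j).
Proof.
move=> ug; elim: s => [|j s IH]; first by rewrite !big_nil -(tmon0 chi); apply: lead_tmon.
by rewrite !big_cons; apply: lead_mul.
Qed.

Lemma tmonX (K : fieldType) (G : zmodType) (chi : bicharacter K G) g m :
  chi g g = 1 -> tmon chi g ^+ m = tmon chi (g *+ m).
Proof.
move=> gg; elim: m => [|m IH]; first by rewrite expr0 mulr0n tmon0.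
rewrite exprS IH tmonM mulrS.
suff -> : chi g (g *+ m) = 1 by rewrite scale1r.
by elim: m {IH} => [|m IH]; rewrite ?mulr0n ?bichar0r // mulrS bicharDr IH gg mulr1.
Qed.

Section Exponents.

Variable n : nat.
Implicit Types (i j : 'I_n) (m : 'I_n -> nat).

Fact dx_x i j : dx i (Some (j, false)) = (i == j)%:R.
Proof. by rewrite ffunE -[Some _ == _]/((i == j) && true) andbT. Qed.
Fact dx_z i j : dx i (Some (j, true)) = 0.
Proof. by rewrite ffunE -[Some _ == _]/((i == j) && false) andbF. Qed.
Fact dx_t i : dx i None = 0. Proof. by rewrite ffunE. Qed.
Fact dz_z i j : dz i (Some (j, true)) = (i == j)%:R.
Proof. by rewrite ffunE -[Some _ == _]/((i == j) && true) andbT. Qed.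
Fact dz_x i j : dz i (Some (j, false)) = 0.
Proof. by rewrite ffunE -[Some _ == _]/((i == j) && false) andbF. Qed.
Fact dz_t i : dz i None = 0. Proof. by rewrite ffunE. Qed.
Fact dt_t : dt n None = 1. Proof. by rewrite ffunE. Qed.
Fact dt_i b j : dt n (Some (j, b)) = 0. Proof. by rewrite ffunE. Qed.

Definition dE := (dx_x, dx_z, dx_t, dz_x, dz_z, dz_t, dt_t, dt_i).

Let sum_delta m j : \sum_i (i == j)%:R *+ m i = (m j)%:Z.
Proof.
rewrite (bigD1 j) //= eqxx big1 ?addr0 ?natz // => i /negbTE->.
by rewrite mul0rn.
Qed.

Lemma sum_dxE m a :
  (\sum_i dx i *+ m i) a = if a is Some (j, false) then (m j)%:Z else 0.
Proof.
rewrite sum_ffunE; case: a => [[j []]|].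
- by rewrite big1 // => i _; rewrite ffunMnE dE mul0rn.
- by rewrite -sum_delta; apply: eq_bigr => i _; rewrite ffunMnE dE.
- by rewrite big1 // => i _; rewrite ffunMnE dE mul0rn.
Qed.

Lemma sum_dzE m a :
  (\sum_i dz i *+ m i) a = if a is Some (j, true) then (m j)%:Z else 0.
Proof.
rewrite sum_ffunE; case: a => [[j []]|].
- by rewrite -sum_delta; apply: eq_bigr => i _; rewrite ffunMnE dE.
- by rewrite big1 // => i _; rewrite ffunMnE dE mul0rn.
- by rewrite big1 // => i _; rewrite ffunMnE dE mul0rn.
Qed.

Lemma dtXE k a : (dt n *+ k) a = if a is None then k%:Z else 0.
Proof. by rewrite ffunMnE; case: a => [[j b]|]; rewrite dE ?mul0rn ?natz. Qed.

(** The leading exponent of the image of [pbw]: each [y_i] contributes [dz i - dx i], from the term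
    of its image that contains [z_i]. *)
Definition pbw_exp (m : {ffun 'I_n -> nat} * {ffun 'I_n -> nat} * nat) :=
  \sum_i (dz i - dx i) *+ m.1.1 i + \sum_i dx i *+ m.1.2 i + dt n *+ m.2.

Lemma pbw_expE (p : {ffun 'I_n -> nat} * {ffun 'I_n -> nat} * nat) a : pbw_exp p a =
  match a with
  | Some (j, true) => (p.1.1 j)%:Z
  | Some (j, false) => (p.1.2 j)%:Z - (p.1.1 j)%:Z
  | None => (p.2)%:Z
  end.
Proof.
have -> : pbw_exp p a = (\sum_i dz i *+ p.1.1 i) a - (\sum_i dx i *+ p.1.1 i) a
    + (\sum_i dx i *+ p.1.2 i) a + (dt n *+ p.2) a.
  by rewrite /pbw_exp; under eq_bigr do rewrite mulrnBl; rewrite sumrB !ffunE.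
rewrite [X in X - _ + _ + _]sum_dzE [X in _ - X + _ + _]sum_dxE.
rewrite [X in _ - _ + X + _]sum_dxE [X in _ - _ + _ + X]dtXE.
by case: a => [[j []]|]; rewrite ?(subr0, addr0, add0r) // addrC.
Qed.

Lemma pbw_exp_inj : injective pbw_exp.
Proof.
move=> [[a b] k] [[a' b'] k'] E.
have {}E c : pbw_exp (a, b, k) c = pbw_exp (a', b', k') c by rewrite E.
have Ea j : a j = a' j by have := E (Some (j, true)); rewrite !pbw_expE => -[].
have Eb j : b j = b' j.
  by have := E (Some (j, false)); rewrite !pbw_expE /= Ea => /addIr[].
have := E None; rewrite !pbw_expE => -[/= ->].
by congr (_, _, _); apply/ffunP.
Qed.

End Exponents.

Section Embedding.

Variables (K : fieldType) (n : nat) (q : 'I_n -> K) (lam : 'M[K]_n).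
Hypothesis hpar : good_params q lam.
Hypothesis hq : no_root_of_unity q.
Variables (R : algType K) (x y : 'I_n -> R) (t : R).
Hypothesis hR : is_Aqt q lam x y t.

Local Notation T := (wtorus hpar).
Local Notation chi := (wchi hpar).
Local Notation xi i := (Some (i, false)).
Local Notation zi i := (Some (i, true)).

Lemma lead_wy i : lead (wy hpar i) (dz i - dx i).
Proof.
apply: leadZ; first by rewrite invr_eq0 q_neq1.
apply: lead_mul; last exact: lead_tmon.
by have := lead_affine chi (zi i) (-1) (oner_neq0 K); rewrite scale1r scaleN1r.
Qed.

Lemma low_wy i : low (wy hpar i) (- dx i).
Proof.
apply: leadZ; first by rewrite invr_eq0 q_neq1.
rewrite -[- dx i]add0r; apply: low_mul; last exact: lead_tmon.
have := low_affine chi (zi i) 1 (_ : -1 != 0).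
by rewrite scale1r scaleN1r; apply; rewrite oppr_eq0 oner_neq0.
Qed.

Definition is_embedding (f : R -> T) :=
  [/\ injective f, forall i, f (x i) = wx hpar i, forall i, f (y i) = wy hpar i
    & f t = wt hpar].

(* The leading exponent of [y^a x^b t^k] determines [(a, b, k)]. *)
Lemma embedding_exists : exists f : {lrmorphism R -> T}, is_embedding f.
Proof.
have [[f [fxy ft]] _] := hR.2 T _ _ _ (wtorus_rel hpar hq).
have fx i : f (x i) = wx hpar i by case: (fxy i).
have fy i : f (y i) = wy hpar i by case: (fxy i).
exists f; split=> //; apply: raddf_inj => r fr0.
pose ex := @pbw_exp n.
have lead_pbw m : lead (f (pbw x y t m)) (ex m).
  rewrite /pbw !rmorphM !rmorph_prod rmorphXn /= ft; apply: lead_mul.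
    apply: lead_mul; apply: lead_prod => i; rewrite rmorphXn /= ?fx ?fy.
      exact/lead_exp/lead_wy.
    exact/lead_exp/lead_tmon.
  exact/lead_exp/lead_tmon.
have ex_inj : injective ex := @pbw_exp_inj n.
have [s [C [us rE]]] := pbw_span_uniq hpar hR r.
have [/allP C0|] := boolP (all (fun m => C m == 0) s).
  by rewrite rE big1_seq // => m /andP[_ /C0 /eqP->]; rewrite scale0r.
rewrite -has_predC => /hasP[m0 m0s /= Cm0].
(* Take the largest leading exponent among the monomials with nonzero coefficient. No other such
   monomial reaches it, so its coefficient in [f r] survives. *)
have [|g /mapP[m]] := max_exists (@lex_posD _) (@lex_pos_total _)
  (s := [seq ex m | m <- s & C m != 0]).
  have : ex m0 \in [seq ex m | m <- s & C m != 0] by rewrite map_f // mem_filter Cm0.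
  by case: (map _ _).
rewrite mem_filter => /andP[Cm ms] -> maxg.
suff: tcoef (ex m) (f r) != 0 by rewrite fr0 tcoef0 eqxx.
rewrite rE linear_sum linear_sum (big_rem m) //= linearZ tcoefZ big1_seq ?addr0; last first.
  move=> m' /andP[_]; rewrite mem_rem_uniq // inE => /andP[m'm m's].
  rewrite linearZ tcoefZ; have [->|Cm'] := eqVneq (C m') 0; first by rewrite mul0r.
  apply/eqP; rewrite mulf_eq0 (negbTE Cm') /=; apply: contraNT m'm => nz.
  apply/eqP/ex_inj.
  have [|//|] := maxg (ex m'); first by rewrite map_f // mem_filter Cm'.
  have [_ /(_ _ nz)[->//|]] := lead_pbw m'.
  move=> p p'; have := pos_asym (lex_pos0 _) (@lex_posD _) p.
  by rewrite opprB p'.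
by apply: mulf_neq0 => //; case: (lead_pbw m).
Qed.
End Embedding.

(** * Weights and normal elements *)

Section Structure.

Variables (K : fieldType) (n : nat) (q : 'I_n -> K) (lam : 'M[K]_n).
Hypothesis hpar : good_params q lam.
Hypothesis hq : no_root_of_unity q.
Variables (R : algType K) (x y : 'I_n -> R) (t : R).
Hypothesis hR : is_Aqt q lam x y t.
Variable f : {lrmorphism R -> wtorus hpar}.
Hypothesis hf : is_embedding x y t f.

Local Notation chi := (wchi hpar).
Local Notation z := (zel q x y).
Local Notation xi i := (Some (i, false)).
Local Notation zi i := (Some (i, true)).
Implicit Types (r u : R) (i j k : 'I_n).

Let finj : injective f. Proof. by case: hf. Qed.
Let fx i : f (x i) = wx hpar i. Proof. by case: hf. Qed.
Let fy i : f (y i) = wy hpar i. Proof. by case: hf. Qed.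
Let ft : f t = wt hpar. Proof. by case: hf. Qed.

Lemma embed_z i : f (z i) = wz hpar i.
Proof. by rewrite -(wz_zel hpar hq) /zel linearD linearZ rmorph1 rmorphM /= fx fy. Qed.

Lemma embed_neq0 r : r != 0 -> f r != 0.
Proof. by rewrite raddf_eq0. Qed.

Lemma Aqt_mulf_neq0 r u : r != 0 -> u != 0 -> r * u != 0.
Proof.
move=> /embed_neq0 r0 /embed_neq0 u0; apply: contraTneq (tmul_neq0 r0 u0).
by rewrite -rmorphM => ->; rewrite rmorph0 eqxx.
Qed.

Definition nneg_exp (g : {ffun option ('I_n * bool) -> int}) :=
  (forall i, 0 <= g (zi i)) /\ 0 <= g None.

(** The only inverses in the images of the generators are those of [x_i], which come from [y_i]. *)
Lemma embed_nneg r g : tcoef g (f r) != 0 -> nneg_exp g.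
Proof.
move: r g; apply: (Aqt_ind hR) => [|c u v IHu IHv g|u v IHu IHv g|i g|i g|g].
- move=> g; rewrite rmorph1 -tmon0 tcoef_tmon.
  have [<- _|] := eqVneq 0 g; last by rewrite eqxx.
  by split=> [i|]; rewrite ffunE.
- rewrite linearP tcoefD tcoefZ.
  have [|/IHu//] := eqVneq (tcoef g (f u)) 0.
  by move=> ->; rewrite mulr0 add0r => /IHv.
- rewrite rmorphM => /tcoefM_neq0[a [b [/IHu[a0 a1] /IHv[b0 b1] ->]]].
  by split=> [i|]; rewrite ffunE addr_ge0.
- rewrite fx tcoef_tmon; have [<- _|] := eqVneq (dx i) g; last by rewrite eqxx.
  by split=> [j|]; rewrite dE.
- rewrite fy tcoefZ mulf_eq0 negb_or => /andP[_ /tcoefM_neq0[a [b [nza + ->]]]].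
  rewrite tcoef_tmon; have [<- _|] := eqVneq (- dx i) b; last by rewrite eqxx.
  suff [az at0] : nneg_exp a by split=> [j|]; rewrite ffunE ffunE dE oppr0 addr0.
  move: nza; rewrite linearB /= -tmon0 !tcoef_tmon.
  have [<- _|_] := eqVneq (dz i) a; first by split=> [j|]; rewrite dE.
  have [<- _|_] := eqVneq 0 a; first by split=> [j|]; rewrite ffunE.
  by rewrite subrr eqxx.
- rewrite ft tcoef_tmon; have [<- _|] := eqVneq (dt n) g; last by rewrite eqxx.
  by split=> [j|]; rewrite dE.
Qed.

Definition no_x (g : {ffun option ('I_n * bool) -> int}) :=
  forall i, g (xi i) = 0.

(** The matrix [wmx] is 1 unless its first index is that of an [x]. *)
Lemma chi_no_x g h : no_x g -> chi g h = 1.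
Proof.
move=> g0; rewrite /= /mxbichar_fun big1 // => a _; rewrite big1 // => b _.
by case: a => [[i []]|]; rewrite /= ?exp1rz ?g0 ?mul0r ?expr0z.
Qed.

Lemma tmonM_no_x g h : no_x g -> tmon chi g * tmon chi h = tmon chi (g + h).
Proof. by move=> g0; rewrite tmonM chi_no_x ?scale1r. Qed.

Lemma no_xD g h : no_x g -> no_x h -> no_x (g + h).
Proof. by move=> g0 h0 i; rewrite ffunE g0 h0. Qed.

Definition zmon (m : 'I_n -> nat) : R := \prod_i z i ^+ m i.

Lemma embed_zmon m : f (zmon m) = tmon chi (\sum_i dz i *+ m i).
Proof.
rewrite /zmon rmorph_prod.
suff [] : \prod_i f (z i ^+ m i) = tmon chi (\sum_i dz i *+ m i)
   /\ no_x (\sum_i dz i *+ m i) by [].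
elim/big_ind2: _ => [|u g v h [-> g0] [-> h0]|i _].
- by rewrite tmon0; split=> // i; rewrite ffunE.
- by rewrite tmonM_no_x //; split=> //; apply: no_xD.
have dz0 : no_x (dz i) by move=> j; rewrite dE.
rewrite rmorphXn /= embed_z tmonX ?chi_no_x //; split=> // j.
by rewrite ffunMnE dE mul0rn.
Qed.

Lemma embed_zt m (k : nat) :
  f (zmon m * t ^+ k) = tmon chi (\sum_i dz i *+ m i + dt n *+ k).
Proof.
have dt0 : no_x (dt n) by move=> j; rewrite dE.
rewrite rmorphM /= embed_zmon rmorphXn /= ft tmonX ?chi_no_x ?tmonM_no_x //.
by move=> i; rewrite sum_dzE.
Qed.

Definition zt_of (g : {ffun option ('I_n * bool) -> int}) : R :=
  zmon (fun i => `|g (zi i)|%N) * t ^+ `|g None|%N.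

Lemma embed_zt_of g : no_x g -> nneg_exp g -> f (zt_of g) = tmon chi g.
Proof.
move=> g0 [gz gt]; rewrite embed_zt; congr (tmon chi _); apply/ffunP => a.
rewrite ffunE [X in X + _]sum_dzE [X in _ + X]dtXE.
by case: a => [[i []]|]; rewrite ?(addr0, add0r) ?gez0_abs ?g0.
Qed.

(** A partial converse of [embed_nneg]: monomials in [z] and [t] with nonnegative exponents are
    images of the elements [zt_of]. It brings elements built in the torus back to [R]. *)
Lemma embed_surj (v : wtorus hpar) :
  (forall g, tcoef g v != 0 -> no_x g /\ nneg_exp g) ->
  v = f (\sum_(g <- msupp v) tcoef g v *: zt_of g).
Proof.
move=> vnn; rewrite linear_sum [LHS]tgalgE; apply: eq_big_seq => g gv.
by have [|g0 gn] := vnn g; rewrite ?tcoef_neq0 // linearZ /= embed_zt_of.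
Qed.

Lemma weight_eq r i c g :
  qcomm c r (z i) -> tcoef g (f r) != 0 -> q i ^ g (xi i) = c.
Proof.
move=> /(congr1 f); rewrite linearZ !rmorphM /= embed_z => E nz.
by rewrite -(wchi_z hpar g i) (tmon_twist E nz) mulfK // bichar_neq0.
Qed.

Lemma weight_x r i (a : int) g :
  qcomm (q i ^ a) r (z i) -> tcoef g (f r) != 0 -> g (xi i) = a.
Proof. by move=> rz /(weight_eq rz); apply: (q_expz_inj hpar hq). Qed.

Lemma weight0 r g : (forall i, qcomm 1 r (z i)) -> tcoef g (f r) != 0 -> no_x g.
Proof. by move=> rz nz i; apply: weight_x nz; rewrite expr0z. Qed.

Lemma zt_expand r : (forall i, qcomm 1 r (z i)) ->
  r = \sum_(g <- msupp (f r)) tcoef g (f r) *: zt_of g.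
Proof.
move=> rz; apply: finj; apply: embed_surj => g nz.
by split; [apply: weight0 nz | apply: embed_nneg nz].
Qed.

(** Each exponent of [f r] is free of [x], so the factor [c] determines its [z_i] entry by
    [wchi_x]. *)
Lemma weight_z r i c g h : (forall i, qcomm 1 r (z i)) -> qcomm c r (x i) ->
  tcoef g (f r) != 0 -> tcoef h (f r) != 0 -> g (zi i) = h (zi i).
Proof.
move=> rz /(congr1 f); rewrite linearZ !rmorphM /= fx => E nzg nzh.
have Eq h0 : tcoef h0 (f r) != 0 -> q i ^ (- h0 (zi i)) = c.
  move=> nz; rewrite -(wchi_x hpar (g := h0)) ?(tmon_twist E nz) ?mulfK ?bichar_neq0 //.
  exact: weight0 nz.
by apply/oppr_inj/(q_expz_inj hpar hq (i := i)); rewrite !Eq.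
Qed.

(** All exponents of [f r] share their [z] entries by [weight_z], so any [g] in the support supplies
    them and only the power of [t] varies. *)
Lemma zmon_poly r : (forall i, qcomm 1 r (z i)) ->
  (forall i, exists c, qcomm c r (x i)) ->
  forall g, tcoef g (f r) != 0 ->
  exists p, r = zmon (fun i => `|g (zi i)|%N) * horner_alg t p.
Proof.
move=> rz rx g nzg.
exists (\sum_(h <- msupp (f r)) tcoef h (f r) *: 'X^`|h None|).
rewrite linear_sum mulr_sumr [LHS]zt_expand //; apply: eq_big_seq => h hr.
rewrite linearZ /= mulr_algl -scalerAr rmorphXn /= horner_algX; congr (_ *: (_ * _)).
apply: eq_bigr => i _; have [c rxi] := rx i.
by rewrite (weight_z rz rxi (_ : tcoef h _ != 0) nzg) // tcoef_neq0.
Qed.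

Lemma central_exp r g i : (forall u, r * u = u * r) ->
  tcoef g (f r) != 0 -> g (zi i) = 0.
Proof.
move=> rc nzg; have rz j : qcomm 1 r (z j) by apply/qcomm1P.
apply: oppr_inj; apply: (q_expz_inj hpar hq (i := i)).
have := congr1 f (rc (x i)); rewrite !rmorphM /= fx => E.
rewrite -(wchi_x hpar (g := g)) ?oppr0 ?expr0z; last exact: weight0 nzg.
by rewrite (tmon_twist (c := 1) _ nzg) ?scale1r // mul1r mulfV ?bichar_neq0.
Qed.

Lemma central_poly r : (forall u, r * u = u * r) -> exists p, r = horner_alg t p.
Proof.
move=> rc; have [->|/embed_neq0/has_lead[g [nzg _]]] := eqVneq r 0.
  by exists 0; rewrite rmorph0.
have [i|i|p ->] := zmon_poly _ _ nzg; first exact/qcomm1P.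
  by exists 1; apply/qcomm1P.
exists p; rewrite /zmon big1 ?mul1r // => i _.
by rewrite (central_exp i rc nzg) expr0.
Qed.

(** The powers of [t] go to distinct monomials, hence [t] is transcendental over [K]. *)
Lemma embed_horner p (k : nat) : tcoef (dt n *+ k) (f (horner_alg t p)) = p`_k.
Proof.
have -> : horner_alg t p = \sum_(i < size p) p`_i *: t ^+ i.
  rewrite -{1}[p]coefK poly_def linear_sum; apply: eq_bigr => i _.
  by rewrite linearZ /= mulr_algl rmorphXn /= horner_algX.
rewrite !linear_sum /=; have Et (i : nat) : f (t ^+ i) = tmon chi (dt n *+ i).
  by rewrite rmorphXn /= ft tmonX // chi_no_x // => j; rewrite dE.
under eq_bigr do rewrite linearZ tcoefZ /= Et tcoef_tmon.
have inj (i : nat) : (dt n *+ i == dt n *+ k) = (i == k).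
  apply/eqP/eqP => [/ffunP/(_ None)|->//]; rewrite !ffunMnE dE => /eqP.
  by rewrite eqr_nat => /eqP.
have [lt|ge] := ltnP k (size p); last first.
  rewrite nth_default // big1 // => i _; rewrite inj ltn_eqF ?mulr0 //.
  exact: leq_trans (ltn_ord i) ge.
rewrite (bigD1 (Ordinal lt)) //= inj eqxx mulr1 big1 ?addr0 // => i ni.
by move: ni; rewrite -val_eqE /= inj => /negbTE->; rewrite mulr0.
Qed.

Lemma horner_t_inj : injective (horner_alg t).
Proof.
move=> p p' E; apply/polyP => k; by rewrite -!embed_horner E.
Qed.

Lemma mul_expx_inv i m : wxi hpar i ^+ m * wx hpar i ^+ m = 1.
Proof.
elim: m => [|m IH]; first by rewrite mulr1.
by rewrite exprSr exprS mulrA -[_ * _ * wx _ _]mulrA wxKi mulr1.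
Qed.

(** Dividing by [x_i^m] inside the torus leaves exponents without [x] and nonnegative elsewhere; by
    [embed_surj] the quotient lies in the image of [R]. *)
Lemma weight_factor r i m :
  qcomm (q i ^+ m) r (z i) -> (forall j, j != i -> qcomm 1 r (z j)) ->
  exists2 r', (forall j, qcomm 1 r' (z j)) & r = r' * x i ^+ m.
Proof.
move=> ri rj; pose v := f r * wxi hpar i ^+ m.
have Exi : wxi hpar i ^+ m = tmon chi (- dx i *+ m).
  by rewrite tmonX // bicharNN mxbichar_delta /= ltnn.
have vnn g : tcoef g v != 0 -> no_x g /\ nneg_exp g.
  rewrite /v Exi => /tcoefM_neq0[a [b [nza + ->]]]; rewrite tcoef_tmon.
  have [<- _|] := eqVneq (- dx i *+ m) b; last by rewrite eqxx.
  have [az at0] := embed_nneg nza; split; last split.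
  - move=> j; rewrite ffunE ffunMnE ffunE dE; have [<-|ij] := eqVneq i j.
      by rewrite mulr1n (weight_x (a := m) ri nza) mulNrn natz subrr.
    rewrite mulr0n oppr0 mul0rn addr0; apply: weight_x nza.
    by rewrite expr0z; apply: rj; rewrite eq_sym.
  - by move=> j; rewrite ffunE ffunMnE ffunE dE oppr0 mul0rn addr0.
  - by rewrite ffunE ffunMnE ffunE dE oppr0 mul0rn addr0.
have Ev := embed_surj vnn; set r' := (X in f X) in Ev; exists r'; last first.
  by apply: finj; rewrite rmorphM rmorphXn /= -Ev fx -mulrA mul_expx_inv mulr1.
move=> j; apply: finj; rewrite linearZ !rmorphM /= -Ev scale1r embed_z [v]tgalgE.
rewrite mulr_suml mulr_sumr; apply: eq_big_seq => g; rewrite -tcoef_neq0.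
move=> /vnn[g0 _]; rewrite -scalerAl -scalerAr tmonM_no_x // tmonM_no_x.
  by rewrite addrC.
by move=> k; rewrite dE.
Qed.

(** [intertwine_tmon] applies to elements with monomial image, thus to [x i] and [z i], but not to
    [y i]. *)
Lemma normal_twist u : u != 0 -> (forall r, exists r', u * r = r' * u) ->
  (forall i, exists c, qcomm c u (x i)) /\ (forall i, exists c, qcomm c u (z i)).
Proof.
move=> /embed_neq0 u0 nu.
have tw r g : f r = tmon chi g -> exists c, qcomm c u r.
  move=> fr; have [r' E] := nu r; have := congr1 f E; rewrite !rmorphM /= fr.
  move=> /(intertwine_tmon u0)[c]; rewrite -fr -linearZ => /finj Er'.
  by exists c; rewrite /qcomm E Er' scalerAl.
by split=> i; [apply: (tw _ (dx i)); rewrite fx | apply: (tw _ (dz i)); rewrite embed_z].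
Qed.

End Structure.

(** The two scalars [a], [b] cover both directions of the exchange: (1, -q) leads to the parameters
    [q^-1], and (-q^-1, 1) leads back. *)
Lemma Aqt_relations_swap (K : fieldType) (n : nat) (q q' : 'I_n -> K)
    (lam : 'M[K]_n) (S : algType K) (x y X Y : 'I_n -> S) (t : S)
    (a b : 'I_n -> K) :
  good_params q lam -> (forall i, q' i * q i = 1) ->
  (forall i, a i * b i = - q i) ->
  (forall i, X i = a i *: y i) -> (forall i, Y i = b i *: x i) ->
  Aqt_relations q lam x y t -> Aqt_relations q' lam X Y t.
Proof.
move=> hpar q'q ab EX EY hrel; split=> [i j ij|]; last split=> i.
- have nij : i != j by rewrite -val_eqE neq_ltn ij.
  have nji : j != i by rewrite eq_sym.
  rewrite !EX !EY; split; apply/qcommZl/qcommZr.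
  + exact: (relyy hpar hrel).
  + exact: (relxx hpar hrel).
  + exact: (relyx hpar hrel).
  + exact: (relyx hpar hrel).
- rewrite EX EY -!scalerAl -!scalerAr !scalerA mulrAC -mulrA ab.
  by rewrite mulrN q'q !scaleNr scale1r opprK addrC (relxyi hrel) addrK.
- by rewrite EX EY -!scalerAl -!scalerAr (reltx hrel) (relty hrel).
Qed.

(** * The presentation of the same algebra with inverse parameters *)

Section Swap.

Variables (K : fieldType) (n : nat) (q : 'I_n -> K) (lam : 'M[K]_n).
Hypothesis hpar : good_params q lam.
Local Notation q' := (fun i => (q i)^-1).

Lemma good_params_swap : good_params q' lam.
Proof. by case: hpar => q0 [? [? ?]]; split=> // i; rewrite invr_eq0. Qed.

Lemma no_root_of_unity_swap : no_root_of_unity q -> no_root_of_unity q'.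
Proof. by move=> hq k m m0; rewrite exprVn invr_eq1 hq. Qed.

Variables (R : algType K) (x y : 'I_n -> R) (t : R).
Hypothesis hR : is_Aqt q lam x y t.
Local Notation y' := (fun i => - q i *: x i).

Lemma is_Aqt_swap : is_Aqt q' lam y y' t.
Proof.
have q0 i : q i != 0 by apply: q_neq0 hpar i.
split=> [|S X Y T hS].
  apply: (Aqt_relations_swap (a := fun=> 1) (b := fun i => - q i) hpar _ _ _ _ hR.1)
    => i //=; by rewrite ?mulVf ?mul1r ?scale1r.
(* Undoes the exchange, so that the universal property of the original presentation applies. *)
pose X' i := - (q i)^-1 *: Y i.
have hS' : Aqt_relations q lam X' X T.
  apply: (Aqt_relations_swap (a := fun i => - (q i)^-1) (b := fun=> 1)
    good_params_swap _ _ _ _ hS) => i //=; by rewrite ?mulfV ?mulr1 ?scale1r.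
have [[f [fxy fT]] U] := hR.2 S X' X T hS'; split.
  exists f; split=> // i; have [fx fy] := fxy i; split=> //.
  by rewrite linearZ /= fx scalerA mulrNN mulfV ?scale1r.
move=> g h gE gt hE ht; apply: U => // i.
  have [gy gx] := gE i; split=> //.
  by rewrite /X' -gx linearZ /= scalerA mulrNN mulVf ?scale1r.
have [hy hx] := hE i; split=> //.
by rewrite /X' -hx linearZ /= scalerA mulrNN mulVf ?scale1r.
Qed.

Lemma zel_swap i : zel q' y y' i = q i *: zel q x y i.
Proof.
have q0 : q i != 0 by apply: q_neq0 hpar i.
rewrite /zel -scalerAl scalerA.
have -> : ((q i)^-1 - 1) * - q i = q i - 1.
  by rewrite mulrN mulrBl mulVf // mul1r opprB.
rewrite (relxyi hR.1) !scalerDr scalerA addrA -{1}(scale1r 1) -scalerDl.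
by rewrite [1 + _]addrC subrK scalerA [_ * q i]mulrC.
Qed.

End Swap.

(** * Normal elements and products affine in one [z] *)

Section Rigidity.

Variables (K : fieldType) (n : nat) (q : 'I_n -> K) (lam : 'M[K]_n).
Hypothesis hpar : good_params q lam.
Hypothesis hq : no_root_of_unity q.
Variables (R : algType K) (x y : 'I_n -> R) (t : R).
Hypothesis hR : is_Aqt q lam x y t.
Variable f : {lrmorphism R -> wtorus hpar}.
Hypothesis hf : is_embedding x y t f.

Local Notation z := (zel q x y).
Implicit Types (r u : R) (i j s : 'I_n).

Definition normal_elt u := forall r, exists r', u * r = r' * u.

Lemma qcomm_zel_swap c r i :
  qcomm c r (zel (fun i => (q i)^-1) y (fun i => - q i *: x i) i) <-> qcomm c r (z i).
Proof.
rewrite (zel_swap hpar hR); split=> [/(@qcommZr _ _ _ (q i)^-1)|]; last exact: qcommZr.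
by rewrite scalerA mulVf ?scale1r // (q_neq0 hpar).
Qed.

(** Let [u] commute with [z_i] up to [d] and with [y_i x_i] up to [e]; the factor for [y_i] comes
    from the second embedding. As [z_i - 1] is a multiple of [y_i x_i] and [u] commutes with 1,
    [((d - e) z_i + (e - 1)) u = 0], which forces d = e = 1. *)
Lemma normal_weight0 u : u != 0 -> normal_elt u ->
  (forall i, qcomm 1 u (z i)) /\ (forall i, exists c, qcomm c u (x i)).
Proof.
move=> u0 nu; have [ux uz] := normal_twist hq hf u0 nu; split=> // i.
have [f' hf'] := embedding_exists (good_params_swap hpar)
  (no_root_of_unity_swap hq) (is_Aqt_swap hpar hR).
have [uy _] := normal_twist (no_root_of_unity_swap hq) hf' u0 nu.
have [[[a Ea] [b Eb]] [d Ed]] := (ux i, uy i, uz i).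
have := @qcommZr _ _ _ (q i - 1) _ _ (qcommMr Eb Ea); set e := b * a.
have -> : (q i - 1) *: (y i * x i) = z i - 1 by rewrite /zel [RHS]addrC addKr.
rewrite /qcomm mulrBr mulr1 Ed mulrBl mul1r scalerBr => E.
have {E} : ((d - e) *: z i + (e - 1)%:A) * u = 0.
  rewrite mulrDl -!scalerAl mul1r !scalerBl scale1r [e *: u - u]addrC addrACA.
  by rewrite [- _ + e *: u]addrC -[X in _ + X]opprB E subrr.
move/(congr1 f); rewrite rmorphM rmorph0 /= => /tmul_eq0[|/eqP]; last first.
  by rewrite raddf_eq0 ?(negbTE u0) //; case: hf.
rewrite linearD !linearZ rmorph1 /= (embed_z hq hf) => E.
have [de|de] := eqVneq (d - e) 0.
  move: E; rewrite de scale0r add0r => /eqP; rewrite scaler_eq0 oner_eq0 orbF subr_eq0.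
  by move=> /eqP e1; move/eqP: de; rewrite subr_eq0 e1 => /eqP <-.
(* If [d] differs from [e], the affine expression in [z_i] has a leading exponent and cannot
   vanish. *)
have := lead_affine (wchi hpar) (Some (i, true)) (e - 1) de.
by rewrite [X in lead X]E => /lead_neq0; rewrite eqxx.
Qed.

(** Weight -m for [q] is weight m for [q^-1], and in the second presentation [y] plays the part of
    [x]. *)
Lemma weight_factor_y r i m :
  qcomm (q i ^- m) r (z i) -> (forall j, j != i -> qcomm 1 r (z j)) ->
  exists2 r', (forall j, qcomm 1 r' (z j)) & r = r' * y i ^+ m.
Proof.
move=> ri rj.
have [f' hf'] := embedding_exists (good_params_swap hpar)
  (no_root_of_unity_swap hq) (is_Aqt_swap hpar hR).
have [||r' r'z ->] := @weight_factor _ _ _ _ (good_params_swap hpar)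
  (no_root_of_unity_swap hq) _ _ _ _ (is_Aqt_swap hpar hR) f' hf' r i m.
- by apply/qcomm_zel_swap; rewrite exprVn.
- by move=> j ji; apply/qcomm_zel_swap/rj.
by exists r' => // j; apply/qcomm_zel_swap.
Qed.

Lemma nneg_sum0 (g h : {ffun option ('I_n * bool) -> int}) :
  nneg_exp g -> no_x g -> nneg_exp h -> no_x h -> g + h = 0 -> g = 0.
Proof.
move=> [gz gt] gx [hz ht] hx gh; apply/ffunP => a.
have := congr1 (fun k : {ffun _ -> int} => k a) gh; rewrite /= !ffunE.
case: a => [[i []]|] /=.
- by move/eqP; rewrite paddr_eq0 // => /andP[/eqP].
- by rewrite gx.
- by move/eqP; rewrite paddr_eq0 // => /andP[/eqP].
Qed.

(** Write [p = p' y_s^m] and [r = r' x_s^m] with [p'], [r'] of weight zero. The [z_s] entry of the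
    leading exponent of [p r] is 1 and at least [m], so [m = 1]. Then nothing is left for the
    exponents of [p'] and [r']: their extremal exponents vanish and both are scalars. *)
Lemma rigid_pair s m p r A B :
  (0 < m)%N -> A != 0 -> B != 0 ->
  qcomm (q s ^- m) p (z s) -> (forall j, j != s -> qcomm 1 p (z j)) ->
  qcomm (q s ^+ m) r (z s) -> (forall j, j != s -> qcomm 1 r (z j)) ->
  p * r = A *: z s + B%:A ->
  [/\ m = 1%N, exists c, p = c *: y s & exists c, r = c *: x s].
Proof.
move=> m0 A0 B0 ps pj rs rj pr.
have [p' p'z Ep] := weight_factor_y ps pj.
have [r' r'z Er] := weight_factor hq hR hf rs rj.
have [finj fx fy _] := hf.
have fpr : f (p * r) = A *: wz hpar s + B%:A.
  by rewrite pr linearD !linearZ rmorph1 /= (embed_z hq hf).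
have leadpr : lead (f (p * r)) (dz s) by rewrite fpr; apply: lead_affine.
have lowpr : low (f (p * r)) 0 by rewrite fpr; apply: low_affine.
have pr0 := lead_neq0 leadpr.
have p'0 : f p' != 0.
  by apply: contraNneq pr0 => E; rewrite Ep !rmorphM /= E !mul0r.
have r'0 : f r' != 0.
  by apply: contraNneq pr0 => E; rewrite Er !rmorphM /= E mul0r mulr0.
have Epr : f (p * r) = f p' * wy hpar s ^+ m * (f r' * wx hpar s ^+ m).
  by rewrite Ep Er !rmorphM !rmorphXn /= fx fy.
have nn u g : (forall j, qcomm 1 u (z j)) -> tcoef g (f u) != 0 ->
    nneg_exp g /\ no_x g.
  by move=> uz nz; split; [apply: (embed_nneg hR hf nz) | apply: (weight0 hq hf uz nz)].
have scal u : (forall j, qcomm 1 u (z j)) -> lead (f u) 0 -> low (f u) 0 ->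
    exists c, u = c%:A.
  move=> uz l1 l2; exists (tcoef 0 (f u)); apply: finj.
  by rewrite [LHS](lead_low_tmon l1 l2) linearZ rmorph1 tmon0.
have [g1 l1] := has_lead p'0; have [g2 l2] := has_lead r'0.
have [h1 w1] := has_low p'0; have [h2 w2] := has_low r'0.
have [[n1 x1] [n2 x2]] := (nn _ _ p'z l1.1, nn _ _ r'z l2.1).
have [[n3 x3] [n4 x4]] := (nn _ _ p'z w1.1, nn _ _ r'z w2.1).
have EL : g1 + (dz s - dx s) *+ m + (g2 + dx s *+ m) = dz s.
  apply: lead_uniq leadpr; rewrite Epr; apply: lead_mul; apply: lead_mul => //.
    exact/lead_exp/lead_wy.
  exact/lead_exp/lead_tmon.
have m1 : m = 1%N.
  have := congr1 (fun k : {ffun _ -> int} => k (Some (s, true))) EL.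
  have -> a : (g1 + (dz s - dx s) *+ m + (g2 + dx s *+ m)) a
      = g1 a + (dz s a - dx s a) *+ m + (g2 a + dx s a *+ m).
    by rewrite !(ffunE, ffunMnE).
  rewrite !dE eqxx mulr1n subr0 mul0rn addr0 natz addrAC => E.
  apply/eqP; rewrite eqn_leq m0 andbT -lez_nat.
  have -> : 1%N%:Z = g1 (Some (s, true)) + g2 (Some (s, true)) + m%:Z by rewrite E.
  by rewrite lerDr addr_ge0 ?n1.1 ?n2.1.
subst m.
have E0 : g1 + g2 = 0.
  move/eqP: EL; rewrite !mulr1n addrACA subrK -{2}[dz s]add0r => /eqP /addIr.
  by [].
(* The lowest exponent of [y_s] is [- dx s], which cancels that of [x_s]; that of [p r] is 0 because
   [B] is nonzero. *)
have F0 : h1 + h2 = 0.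
  apply: low_uniq lowpr; rewrite Epr.
  have -> : h1 + h2 = h1 + - dx s + (h2 + dx s) by rewrite addrACA addNr addr0.
  rewrite !expr1; apply: low_mul; apply: low_mul => //; first exact: low_wy.
  exact: lead_tmon.
have g10 := nneg_sum0 n1 x1 n2 x2 E0; have h10 := nneg_sum0 n3 x3 n4 x4 F0.
have g20 : g2 = 0 by move: E0; rewrite g10 add0r.
have h20 : h2 = 0 by move: F0; rewrite h10 add0r.
rewrite g10 in l1; rewrite g20 in l2; rewrite h10 in w1; rewrite h20 in w2.
have [c Ec] := scal _ p'z l1 w1; have [d Ed] := scal _ r'z l2 w2.
split=> //; first by exists c; rewrite Ep Ec expr1 mulr_algl.
by exists d; rewrite Er Ed expr1 mulr_algl.
Qed.

End Rigidity.

(** * Automorphisms *)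

Lemma qcomm_morph (K : fieldType) (S S' : algType K) (f : {lrmorphism S -> S'})
    (c : K) (u v : S) : qcomm c u v -> qcomm c (f u) (f v).
Proof. by move=> E; rewrite /qcomm -!rmorphM -linearZ E. Qed.

Section HornerAlg.

Variables (K : fieldType) (S : algType K).
Implicit Types (r : S) (p : {poly K}).

Lemma horner_algMXaddC r (p : {poly K}) c :
  horner_alg r (p * 'X + c%:P) = horner_alg r p * r + c%:A.
Proof. by rewrite rmorphD rmorphM /= horner_algX horner_algC. Qed.

Lemma horner_alg_comp r (p p' : {poly K}) :
  horner_alg r (p \Po p') = horner_alg (horner_alg r p') p.
Proof.
elim/poly_ind: p => [|p c IH]; first by rewrite comp_poly0 !rmorph0.
rewrite comp_polyD comp_polyM comp_polyX comp_polyC horner_algMXaddC -IH.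
by rewrite rmorphD rmorphM /= horner_algC.
Qed.

Lemma horner_alg_central r (p : {poly K}) :
  (forall u, r * u = u * r) -> forall u, horner_alg r p * u = u * horner_alg r p.
Proof.
move=> rc u; elim/poly_ind: p => [|p c IH]; first by rewrite rmorph0 mulr0 mul0r.
rewrite horner_algMXaddC mulrDl mulrDr mulr_algl mulr_algr.
by rewrite -mulrA rc [_ * (u * r)]mulrA IH mulrA.
Qed.

End HornerAlg.

Section Automorphism.

Variables (K : fieldType) (n : nat) (q : 'I_n -> K) (lam : 'M[K]_n).
Hypothesis hpar : good_params q lam.
Hypothesis hq : no_root_of_unity q.
Variables (R : algType K) (x y : 'I_n -> R) (t : R).
Hypothesis hR : is_Aqt q lam x y t.
Variable f : {lrmorphism R -> wtorus hpar}.
Hypothesis hf : is_embedding x y t f.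
Variables (phi : {lrmorphism R -> R}) (psi : R -> R).
Hypotheses (phiK : cancel phi psi) (psiK : cancel psi phi).

Local Notation z := (zel q x y).
Implicit Types (r u : R) (i j k s : 'I_n).

Let finj : injective f. Proof. by case: hf. Qed.
Let phi_inj : injective phi := can_inj phiK.
Let q_neq1' i : q i - 1 != 0 := q_neq1 hq i.

(** The elements [r] that [z i] can be moved across form a subalgebra, so the generators suffice. *)
Lemma zel_normal i : normal_elt (z i).
Proof.
apply: (Aqt_ind hR) => [|c u v [u' Eu] [v' Ev]|u v [u' Eu] [v' Ev]|j|j|].
- by exists 1; rewrite mulr1 mul1r.
- by exists (c *: u' + v'); rewrite mulrDr -scalerAr Eu Ev [RHS]mulrDl -scalerAl.
- by exists (u' * v'); rewrite mulrA Eu -mulrA Ev mulrA.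
- have nz : (if j == i then q j else 1) != 0.
    by case: ifP => _; rewrite ?oner_neq0 ?(q_neq0 hpar).
  have := qcommC nz (zel_x hpar hR.1 j i); rewrite /qcomm => ->.
  by eexists; apply: scalerAl.
- have nz : (if j == i then (q j)^-1 else 1) != 0.
    by case: ifP => _; rewrite ?oner_neq0 // invr_eq0 (q_neq0 hpar).
  have := qcommC nz (zel_y hpar hR.1 j i); rewrite /qcomm => ->.
  by eexists; apply: scalerAl.
- exists t; rewrite mulrDr mulrDl mulr1 mul1r -scalerAl -scalerAr.
  by rewrite [t * _]mulrA (relty hR.1) -[y i * t * _]mulrA (reltx hR.1) !mulrA.
Qed.

Lemma t_central r : t * r = r * t.
Proof.
move: r; apply: (Aqt_ind hR) => [|c u v Eu Ev|u v Eu Ev|j|j|] //.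
- by rewrite mulr1 mul1r.
- by rewrite mulrDr mulrDl -scalerAr -scalerAl Eu Ev.
- by rewrite mulrA Eu -mulrA Ev mulrA.
- exact: (reltx hR.1).
- exact: (relty hR.1).
Qed.

Lemma z_neq0 i : z i != 0.
Proof. by apply/eqP => /(congr1 f) /eqP; rewrite (embed_z hq hf) rmorph0 (negbTE (tmon_neq0 _ _)). Qed.

Lemma z_not_central i : ~ (forall r, z i * r = r * z i).
Proof.
move=> zc; have := zel_x hpar hR.1 i i; rewrite eqxx /qcomm -zc => /eqP.
rewrite -subr_eq0 -{1}[z i * x i]scale1r -scalerBl scaler_eq0 subr_eq0 eq_sym -subr_eq0.
rewrite (negbTE (q_neq1' i)) /=; apply/negP.
apply: (Aqt_mulf_neq0 hf (z_neq0 i)); apply/eqP => /(congr1 f) /eqP.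
by case: hf => _ -> _ _; rewrite rmorph0 (negbTE (tmon_neq0 _ _)).
Qed.

Lemma phi_normal u : normal_elt u -> normal_elt (phi u).
Proof.
move=> nu r; have [r' E] := nu (psi r); exists (phi r').
by rewrite -rmorphM -E rmorphM /= psiK.
Qed.

Lemma psi_normal u : normal_elt u -> normal_elt (psi u).
Proof.
move=> nu r; have [r' E] := nu (phi r); exists (psi r').
by apply: phi_inj; rewrite !rmorphM /= !psiK.
Qed.

Lemma phi_central u : (forall r, u * r = r * u) -> forall r, phi u * r = r * phi u.
Proof. by move=> uc r; rewrite -[r]psiK -!rmorphM uc. Qed.

Lemma psi_central u : (forall r, u * r = r * u) -> forall r, psi u * r = r * psi u.
Proof. by move=> uc r; apply: phi_inj; rewrite !rmorphM /= psiK uc. Qed.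

Lemma phi_neq0 u : u != 0 -> phi u != 0.
Proof. by apply: contra_neq => E; apply: phi_inj; rewrite rmorph0. Qed.

Lemma psi_neq0 u : u != 0 -> psi u != 0.
Proof. by apply: contra_neq => E; rewrite -[u]psiK E rmorph0. Qed.

Lemma phi_horner r p : phi (horner_alg r p) = horner_alg (phi r) p.
Proof.
elim/poly_ind: p => [|p c IH]; first by rewrite !rmorph0.
by rewrite !horner_algMXaddC linearD linearZ rmorphM rmorph1 /= IH.
Qed.

Lemma phi_t : exists a b, a != 0 /\ phi t = a *: t + b%:A.
Proof.
have [P EP] := central_poly hq hR hf (phi_central t_central).
have [Q EQ] := central_poly hq hR hf (psi_central t_central).
have E : 'X = Q \Po P.
  apply: (horner_t_inj hf); rewrite horner_algX -[LHS]psiK EQ phi_horner EP.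
  by rewrite horner_alg_comp.
(* Degrees multiply under composition, so [P] has degree 1. *)
have := size_comp_poly Q P; rewrite -E size_polyX /= => /esym/eqP.
rewrite muln_eq1 => /andP[_ /eqP sP].
have {}sP : size P = 2%N by case: (size P) sP => [|[|[|k]]].
exists P`_1, P`_0; split.
  have : lead_coef P != 0 by rewrite lead_coef_eq0 -size_poly_eq0 sP.
  by rewrite lead_coefE sP.
rewrite EP -{1}[P]coefK poly_def sP !big_ord_recl big_ord0 addr0 addrC linearD.
by rewrite !linearZ /= !mulr_algl expr1 horner_algX expr0 rmorph1.
Qed.

Lemma normal_form u : u != 0 -> normal_elt u ->
  forall g, tcoef g (f u) != 0 ->
  exists p, u = zmon q x y (fun i => `|g (Some (i, true))|%N) * horner_alg t p.
Proof.
by move=> u0 nu; have [uz ux] := normal_weight0 hq hR hf u0 nu; apply: zmon_poly.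
Qed.

(** With degree 0, [phi (z k)] would be a polynomial in [t], hence central, although [z k] is
    not. *)
Lemma phi_z_degree k g : tcoef g (f (phi (z k))) != 0 ->
  1 <= \sum_i g (Some (i, true)).
Proof.
move=> nz; have [gz _] := embed_nneg hR hf nz.
have [p E] := normal_form (phi_neq0 (z_neq0 k)) (phi_normal (@zel_normal k)) nz.
rewrite -gtz0_ge1 lt_neqAle sumr_ge0 // andbT eq_sym; apply/eqP => /eqP.
rewrite psumr_eq0 // => /allP g0; case: (@z_not_central k) => r.
have {}g0 i : g (Some (i, true)) = 0 by apply/eqP/g0; rewrite mem_index_enum.
apply: phi_inj; rewrite !rmorphM /= E /zmon big1 => [|i _]; last by rewrite g0.
by rewrite mul1r; apply/horner_alg_central/t_central.
Qed.

(** The normal form is taken for [psi (z j)] and then pushed through [phi]: [z j] becomes a product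
    of powers of the [phi (z k)] and a central factor, whose total degree in the [z] variables is
    1. *)
Lemma phi_z j : exists k c, c != 0 /\ phi (z k) = c *: z j.
Proof.
have zj0 := z_neq0 j; have w0 := psi_neq0 zj0.
have nw := psi_normal (@zel_normal j).
have [g [nzg _]] := has_lead (embed_neq0 hf w0).
have [p Ew] := normal_form w0 nw nzg; set m := (fun i => _) in Ew.
set v := horner_alg t p in Ew.
have vc : forall r, v * r = r * v := horner_alg_central p t_central.
have {}vc := phi_central vc.
have Ez : z j = phi (zmon q x y m) * phi v.
  by have := congr1 phi Ew; rewrite psiK rmorphM.
have fzj : f (z j) = wz hpar j by rewrite (embed_z hq hf).
have v0 : phi v != 0 by apply: contraNneq zj0 => E; rewrite Ez E mulr0.
have [gv lv] := has_lead (embed_neq0 hf v0).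
have [G lG] : exists G, forall k, lead (f (phi (z k))) (G k).
  apply: (@fin_all_exists _ (fun=> {ffun option ('I_n * bool) -> int})
    (fun k => lead (f (phi (z k))))) => k.
  exact/has_lead/(embed_neq0 hf)/phi_neq0/z_neq0.
have EL : \sum_k G k *+ m k + gv = dz j.
  apply: (@lead_uniq _ _ _ (f (z j))); last by rewrite fzj; apply: lead_tmon.
  rewrite Ez rmorphM; apply: lead_mul => //.
  rewrite /zmon !rmorph_prod; apply: lead_prod => k; rewrite !rmorphXn /=.
  exact: lead_exp.
pose D k := \sum_i G k (Some (i, true)).
have D1 k : 1 <= D k by apply: phi_z_degree (lG k).1.
(* The central factor [phi v] has no [z] exponents, so only the [phi (z k)] contribute. *)
have ED : \sum_k D k *+ m k = 1.
  have -> : 1 = \sum_i dz j (Some (i, true)).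
    by rewrite (bigD1 j) //= dE eqxx big1 ?addr0 // => i /negbTE ij; rewrite dE eq_sym ij.
  rewrite -EL; under eq_bigr do rewrite -sumrMnl.
  rewrite exchange_big; apply: eq_bigr => i _; rewrite ffunE sum_ffunE.
  rewrite (central_exp hq hf i vc lv.1) addr0; apply: eq_bigr => k _.
  by rewrite ffunMnE.
have Dm0 k : 0 <= D k *+ m k by rewrite mulrn_wge0 // (le_trans ler01 (D1 k)).
have [k mk] : exists k, m k != 0%N.
  apply/existsP; apply: contraTT isT => /existsPn m0.
  have := ED; rewrite big1 => [/eqP|k _]; first by rewrite eq_sym oner_eq0.
  by have := m0 k; rewrite negbK => /eqP->.
have mle : (\sum_i m i <= 1)%N.
  rewrite -(ler_nat int) natr_sum.
  apply: (@le_trans _ _ (\sum_k D k *+ m k)); last by rewrite ED.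
  apply: ler_sum => i _.
  by apply: ler_wMn2r; apply: D1.
have [mk1 mk0] : m k = 1%N /\ forall i, i != k -> m i = 0%N.
  move: mle; rewrite (bigD1 k) //=; case: (m k) mk => // a _.
  rewrite addSn ltnS leqn0 addn_eq0 sum_nat_eq0 => /andP[/eqP-> /forall_inP m0].
  by split=> // i ik; apply/eqP/m0.
have {}Ez : z j = phi (z k) * phi v.
  rewrite Ez; congr (phi _ * _).
  rewrite /zmon (eq_bigr (fun i => if i == k then z i else 1)) => [|i _].
    by rewrite -big_mkcond big_pred1_eq.
  by have [->|/mk0->] := eqVneq i k; rewrite ?mk1 ?expr0.
(* [phi v] contributes at most powers of [t], and those are excluded by nonnegativity since [dz j]
   has none. Both extremal exponents of [phi (z k)] are therefore [dz j]. *)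
have only a b : tcoef a (f (phi (z k))) != 0 -> tcoef b (f (phi v)) != 0 ->
    a + b = dz j -> a = dz j.
  move=> nza nzb ab; apply/ffunP => c.
  have [_ a0] := embed_nneg hR hf nza; have [_ b0] := embed_nneg hR hf nzb.
  have := congr1 (fun g : {ffun _ -> int} => g c) ab; rewrite /= ffunE.
  have vz i : qcomm 1 (phi v) (z i) by apply/qcomm1P.
  case: c => [[i []]|].
  - by rewrite (central_exp hq hf i vc nzb) addr0.
  - by rewrite (weight0 hq hf vz nzb) addr0.
  - by rewrite dE => /eqP; rewrite paddr_eq0 // => /andP[/eqP].
have [h lowz] := has_low (embed_neq0 hf (phi_neq0 (z_neq0 k))).
have [hv lowv] := has_low (embed_neq0 hf v0).
have Gj : G k = dz j.
  apply: only (lG k).1 lv.1 _; apply: (@lead_uniq _ _ _ (f (z j))).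
    by rewrite Ez rmorphM; apply: lead_mul; first exact: lG.
  by rewrite fzj; apply: lead_tmon.
have hj : h = dz j.
  apply: only lowz.1 lowv.1 _; apply: (@low_uniq _ _ _ (f (z j))).
    by rewrite Ez rmorphM; apply: low_mul.
  by rewrite fzj; apply: lead_tmon.
have lGk := lG k; rewrite Gj in lGk; rewrite hj in lowz.
exists k, (tcoef (dz j) (f (phi (z k)))); split; first exact: lGk.1.
by apply: finj; rewrite [LHS](lead_low_tmon lGk lowz) linearZ /= fzj.
Qed.

Lemma phi_perm_z : exists sigma : {perm 'I_n},
  forall i, exists2 c, c != 0 & phi (z i) = c *: z (sigma i).
Proof.
have [F HF] : exists F : 'I_n -> 'I_n * K,
    forall j, (F j).2 != 0 /\ phi (z (F j).1) = (F j).2 *: z j.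
  apply: (@fin_all_exists _ (fun=> ('I_n * K)%type)
    (fun j F => F.2 != 0 /\ phi (z F.1) = F.2 *: z j)) => j.
  by have [k [c kc]] := phi_z j; exists (k, c).
have F_inj : injective (fun j => (F j).1).
  move=> j j' /= E; have [c0 Ej] := HF j; have [_ Ej'] := HF j'.
  move: Ej'; rewrite -E Ej => /(congr1 f)/(congr1 (tcoef (dz j))).
  rewrite !linearZ /= !(embed_z hq hf) !tcoef_tmon eqxx mulr1 => Ec.
  have /eqP/ffunP/(_ (Some (j, true))) : dz j' == dz j.
    by apply: contraNT c0 => /negbTE E0; rewrite Ec E0 mulr0.
  by rewrite !dE eqxx; case: eqVneq.
(* [F] sends [j] to the index whose image is a multiple of [z j], hence the inverse. *)
exists (perm F_inj)^-1%g => i; set j := ((perm F_inj)^-1%g i).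
have [c0 E] := HF j; exists (F j).2 => //; rewrite -E; congr (phi (z _)).
by rewrite -[LHS](permKV (perm F_inj)) -/j permE.
Qed.

(** Conjugation by the [z] shows that the exponent of [x_s] in [phi (x i)] is some k with
    [q s ^ k = q i], and that the other [x] exponents vanish. Here k is nonzero as [q i] is not 1;
    its sign decides whether [phi (x i)] is a multiple of [x s] or of [y s], recorded by [b]. *)
Lemma phi_gen (sigma : {perm 'I_n}) i :
  (forall i, exists2 c, c != 0 & phi (z i) = c *: z (sigma i)) ->
  exists (b : bool) (al be : K),
  if b then [/\ q (sigma i) = q i, phi (x i) = al *: x (sigma i)
              & phi (y i) = be *: y (sigma i)]
  else [/\ q (sigma i) = (q i)^-1, phi (x i) = al *: y (sigma i)
         & phi (y i) = be *: x (sigma i)].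
Proof.
move=> hs; set s := sigma i.
have push d u j : qcomm d u (z j) -> qcomm d (phi u) (z (sigma j)).
  move=> /(qcomm_morph phi); have [c c0 ->] := hs j.
  by move/(@qcommZr _ _ _ c^-1); rewrite scalerA mulVf // scale1r.
have xs : qcomm (q i) (phi (x i)) (z s).
  by apply: push; have := zel_x hpar hR.1 i i; rewrite eqxx.
have ys : qcomm (q i)^-1 (phi (y i)) (z s).
  by apply: push; have := zel_y hpar hR.1 i i; rewrite eqxx.
have off j : j != s -> (i == (sigma^-1)%g j) = false.
  by apply: contraNF => /eqP E; rewrite /s E permKV.
have xj j : j != s -> qcomm 1 (phi (x i)) (z j).
  move=> js; rewrite -(permKV sigma j); apply: push.
  by have := zel_x hpar hR.1 i ((sigma^-1)%g j); rewrite off.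
have yj j : j != s -> qcomm 1 (phi (y i)) (z j).
  move=> js; rewrite -(permKV sigma j); apply: push.
  by have := zel_y hpar hR.1 i ((sigma^-1)%g j); rewrite off.
have [c c0 Ec] := hs i; rewrite -/s in Ec.
pose d := (q i - 1)^-1; have d0 : d != 0 by rewrite invr_eq0 q_neq1'.
(* The image of [y_i x_i = (q_i - 1)^-1 (z_i - 1)], with [d] the inverse of [q_i - 1]. *)
have Eyx : phi (y i) * phi (x i) = (d * c) *: z s + (- d)%:A.
  rewrite -rmorphM -scalerA -Ec scaleNr -scalerBr.
  have -> : phi (z i) - 1 = (q i - 1) *: phi (y i * x i).
    by rewrite /zel linearD linearZ rmorph1 /= [LHS]addrC addKr.
  by rewrite scalerA mulVf ?scale1r ?q_neq1'.
(* The constant term is [1 - q_i d = - d], because [(q_i - 1) d = 1]. *)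
have Exy : phi (x i) * phi (y i) = (q i * (d * c)) *: z s + (- d)%:A.
  have -> : phi (x i) * phi (y i) = 1 + q i *: (phi (y i) * phi (x i)).
    by rewrite -!rmorphM -[1](rmorph1 phi) -linearZ -linearD (relxyi hR.1).
  rewrite Eyx.
  rewrite scalerDr !scalerA addrCA; congr (_ + _).
  rewrite -{1}(scale1r 1) -scalerDl; congr (_ *: _).
  rewrite mulrN -[X in X - _](mulfV (q_neq1' i)) -/d mulrBl mul1r.
  by rewrite addrAC subrr add0r.
have dc0 : d * c != 0 by rewrite mulf_neq0.
have Nd0 : - d != 0 by rewrite oppr_eq0.
have x0 : phi (x i) != 0.
  apply/phi_neq0/eqP => /(congr1 f) /eqP; case: hf => _ -> _ _.
  by rewrite rmorph0 (negbTE (tmon_neq0 _ _)).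
have [g [nzg _]] := has_lead (embed_neq0 hf x0).
have := weight_eq hq hf xs nzg; case: (g _) => [[|m]|m] qE.
- by have := q_neq1' i; rewrite -qE subrr eqxx.
- have [||m1 [be Ebe] [al Eal]] := rigid_pair hq hR hf (ltn0Sn m) dc0 Nd0 _ yj _ xj Eyx.
  + by move: ys; rewrite -qE.
  + by move: xs; rewrite -qE.
  by exists true, al, be; split=> //; move: qE; rewrite m1.
(* For negative weight [phi (x i)] takes the part of the [y] factor, so the product in the opposite
   order is used. *)
- have qE' : (q i)^-1 = q s ^+ m.+1 by rewrite -qE NegzE -invr_expz invrK.
  have [|||m1 [al Eal] [be Ebe]] :=
    rigid_pair hq hR hf (ltn0Sn m) _ Nd0 _ xj _ yj Exy.
  + by rewrite mulf_neq0 ?(q_neq0 hpar).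
  + by move: xs; rewrite -qE'  invrK.
  + by move: ys; rewrite qE'.
  by exists false, al, be; split=> //; rewrite qE' m1 expr1.
Qed.

End Automorphism.

Lemma qcomm_unscale (K : fieldType) (S : algType K) (a b c : K) (u v : S) :
  a != 0 -> b != 0 -> qcomm c (a *: u) (b *: v) -> qcomm c u v.
Proof.
move=> a0 b0 /(@qcommZl _ _ _ a^-1)/(@qcommZr _ _ _ b^-1).
by rewrite !scalerA !mulVf // !scale1r.
Qed.

(** Makes the entries of [lam] recoverable from the commutation of generators. *)
Lemma qcomm_inj (K : fieldType) (S : algType K) (c d : K) (u v : S) :
  v * u != 0 -> qcomm c u v -> qcomm d u v -> c = d.
Proof.
rewrite /qcomm => vu -> /eqP; rewrite -subr_eq0 -scalerBl scaler_eq0.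
by rewrite (negbTE vu) orbF subr_eq0 => /eqP.
Qed.

Theorem theorem2p4 (K : fieldType) (n : nat) (hn : (1 <= n)%N)
    (q : 'I_n -> K) (lam : 'M[K]_n)
    (hpar : good_params q lam) (hq : no_root_of_unity q)
    (R : algType K) (x y : 'I_n -> R) (t : R)
    (hR : is_Aqt q lam x y t)
    (phi : {lrmorphism R -> R}) (hphi : bijective phi) :
  exists (P1 : {set 'I_n}) (sigma : {perm 'I_n}) (alpha : 'I_n -> K) (a b : K),
    [/\ (forall i, i \in P1 -> q (sigma i) = q i),
        (forall i, i \notin P1 -> q (sigma i) = (q i)^-1),
        (forall i j, (i \in P1) = (j \in P1) -> lam (sigma i) (sigma j) = lam i j),
        (forall i j, i \in P1 -> j \notin P1 -> lam (sigma i) (sigma j) = (lam i j)^-1) &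
        (forall i, alpha i != 0) /\ a != 0] /\
    [/\ (forall i, i \in P1 ->
           phi (x i) = alpha i *: x (sigma i) /\ phi (y i) = (alpha i)^-1 *: y (sigma i)),
        (forall i, i \notin P1 ->
           phi (x i) = alpha i *: y (sigma i) /\
           phi (y i) = (- (q i)^-1 * (alpha i)^-1) *: x (sigma i))
      & phi t = a *: t + b%:A ].
Proof.
have [psi phiK psiK] := hphi; have hrel := hR.1.
have [f hf] := embedding_exists hpar hq hR.
have [a [b [a0 phit]]] := phi_t hq hR hf phiK psiK.
have [sigma hs] := phi_perm_z hq hR hf phiK psiK.
have [F HF] : exists F : 'I_n -> bool * K * K, forall i,
  if (F i).1.1 then [/\ q (sigma i) = q i, phi (x i) = (F i).1.2 *: x (sigma i)
              & phi (y i) = (F i).2 *: y (sigma i)]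
  else [/\ q (sigma i) = (q i)^-1, phi (x i) = (F i).1.2 *: y (sigma i)
         & phi (y i) = (F i).2 *: x (sigma i)].
  apply: (@fin_all_exists _ (fun=> (bool * K * K)%type) (fun i F => if F.1.1 then
    [/\ q (sigma i) = q i, phi (x i) = F.1.2 *: x (sigma i)
              & phi (y i) = F.2 *: y (sigma i)]
    else [/\ q (sigma i) = (q i)^-1, phi (x i) = F.1.2 *: y (sigma i)
         & phi (y i) = F.2 *: x (sigma i)])) => i.
  by have [e [al [be H]]] := phi_gen hq hR hf phiK i hs; exists (e, al, be).
pose P1 := [set i | (F i).1.1]; pose al i := (F i).1.2; pose be i := (F i).2.
have inP i : i \in P1 -> [/\ q (sigma i) = q i, phi (x i) = al i *: x (sigma i)
    & phi (y i) = be i *: y (sigma i)].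
  by rewrite inE => Fi; have := HF i; rewrite Fi.
have notinP i : i \notin P1 -> [/\ q (sigma i) = (q i)^-1,
    phi (x i) = al i *: y (sigma i) & phi (y i) = be i *: x (sigma i)].
  by rewrite inE => /negbTE Fi; have := HF i; rewrite Fi.
have q0 i : q i != 0 := q_neq0 hpar i.
have one c : c *: (1 : R) = 1 -> c = 1.
  move=> /eqP; rewrite -subr_eq0 -{2}(scale1r 1) -scalerBl scaler_eq0 oner_eq0 orbF.
  by rewrite subr_eq0 => /eqP.
have rel_phi i : phi (x i) * phi (y i) - q i *: (phi (y i) * phi (x i)) = 1.
  by rewrite -!rmorphM -linearZ -linearB (hrel.2.1 i) rmorph1.
have mulZZ c d (u v : R) : (c *: u) * (d *: v) = (c * d) *: (u * v).
  by rewrite -scalerAl -scalerAr scalerA.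
(* The defining relation of index [i], mapped by [phi], is [al i * be i] times the relation of index
   [sigma i]. *)
have albe_in i : i \in P1 -> al i * be i = 1.
  move=> /inP[Eq Ex Ey]; apply: one; have := rel_phi i; rewrite Ex Ey !mulZZ.
  rewrite [be i * _]mulrC scalerA [q i * _]mulrC -[(_ * q i) *: _]scalerA -scalerBr -Eq.
  by rewrite (hrel.2.1 (sigma i)).
(* With [q (sigma i) = (q i)^-1] one has [y x - q_i x y = - q_i] at index [sigma i]; this is the
   origin of the factor [- (q i)^-1] in the formula for [phi (y i)]. *)
have albe_notin i : i \notin P1 -> al i * be i * - q i = 1.
  move=> /notinP[Eq Ex Ey]; apply: one; have := rel_phi i; rewrite Ex Ey !mulZZ.
  rewrite [be i * _]mulrC scalerA [q i * _]mulrC -[(_ * q i) *: _]scalerA -scalerBr.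
  rewrite (relxyi hrel) [q i *: (_ + _)]scalerDr scalerA Eq mulfV // scale1r opprD addrCA subrr.
  by rewrite addr0 -scaleNr scalerA.
have al0 i : al i != 0.
  have [/albe_in|/albe_notin] := boolP (i \in P1) => E; apply/eqP => al0.
    by have := oner_neq0 K; rewrite -E al0 mul0r eqxx.
  by have := oner_neq0 K; rewrite -E al0 !mul0r eqxx.
have x0 i : x i != 0.
  apply/eqP => /(congr1 f) /eqP; case: hf => _ -> _ _.
  by rewrite rmorph0 (negbTE (tmon_neq0 _ _)).
have y0 i : y i != 0.
  apply/eqP => /(congr1 f) /eqP; case: hf => _ _ -> _.
  by rewrite rmorph0 (negbTE (lead_neq0 (lead_wy hpar hq i))).
have dom u v : u != 0 -> v != 0 -> u * v != 0 := @Aqt_mulf_neq0 _ _ _ _ _ _ _ _ _ _ hf u v.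
have phixx i j : i != j -> qcomm (lam i j) (phi (x i)) (phi (x j)).
  by move=> ij; apply/qcomm_morph/(relxx hpar hrel).
have lam1 i : lam i i = 1 by have [_ [_ [_ ->]]] := hpar.
exists P1, sigma, al, a, b; split; split=> //.
- by move=> i /inP[].
- by move=> i /notinP[].
- move=> i j ij; have [->|nij] := eqVneq i j; first by rewrite !lam1.
  have nsij : sigma i != sigma j by rewrite (inj_eq perm_inj).
  have := phixx _ _ nij; have [/[dup] Pi /inP[_ -> _]|/[dup] Pi /notinP[_ -> _]] := boolP (i \in P1).
    have [_ -> _] := inP j (etrans (esym ij) Pi).
    move=> /(qcomm_unscale (al0 _) (al0 _)); apply: qcomm_inj; first exact: dom.
    exact: (relxx hpar hrel).
  have Pj : j \notin P1 by rewrite -ij.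
  (* Two [y] commute with the same factor as the two [x] of the same indices. *)
  have [_ -> _] := notinP j Pj.
  move=> /(qcomm_unscale (al0 _) (al0 _)); apply: qcomm_inj; first exact: dom.
  exact: (relyy hpar hrel).
- move=> i j Pi Pj; have nij : i != j by apply: contraNneq Pj => <-.
  have nsij : sigma i != sigma j by rewrite (inj_eq perm_inj).
  (* Here an [x] meets a [y], whose factor is the transposed entry of [lam]; this produces the
     inverse. *)
  have := phixx _ _ nij; have [_ -> _] := inP i Pi; have [_ -> _] := notinP j Pj.
  move=> /(qcomm_unscale (al0 _) (al0 _)) E; rewrite -(lamV hpar); congr (_^-1).
  by apply: qcomm_inj E; [exact: dom | exact: (relxy hrel)].
- move=> i /[dup] /albe_in ab /inP[_ -> ->]; split=> //.
  by congr (_ *: _); apply: (mulfI (al0 i)); rewrite mulfV.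
- move=> i /[dup] /albe_notin ab /notinP[_ -> ->]; split=> //; congr (_ *: _).
  have al_q0 : al i * - q i != 0 by rewrite mulf_neq0 ?oppr_eq0.
  apply: (mulfI al_q0); rewrite mulrAC ab [- _^-1 * _]mulrC mulrACA mulrNN.
  by rewrite !mulfV // mul1r.
Qed.
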